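(* Let $m,n$ be positive integers, let $H_m=H^2(\mathbb{D}^m)$, and let $T$ be a bounded linear operator on $H^2_{H_m}(\mathbb{D}^n)$. Then $T$ satisfies $$TM_{z_j}=M_{z_j}T\quad\text{for } j=1,\ldots,n\qquad\text{and}\qquad TM_{\kappa_i}^*=M_{\kappa_i}^*T\quad\text{for } i=1,\ldots,m$$ if and only if $T=M_\Phi$, where $\Phi\in H^\infty_{\mathcal{B}(H_m)}(\mathbb{D}^n)$ is given by $$\Phi(\boldsymbol{z})=\sum_{\boldsymbol{k}\in\mathbb{Z}_+^n}M_{\Theta_{\boldsymbol{k}}}^*\boldsymbol{z}^{\boldsymbol{k}},\qquad \Theta_{\boldsymbol{k}}(\boldsymbol{w})=\sum_{\boldsymbol{l}\in\mathbb{Z}_+^m}\langle M_{\boldsymbol{z}}^{\boldsymbol{k}}\boldsymbol{1},\,T\boldsymbol{w}^{\boldsymbol{l}}\rangle_{H^2_{H_m}(\mathbb{D}^n)}\,\boldsymbol{w}^{\boldsymbol{l}}$$ for all $\boldsymbol{z}=(z_1,\ldots,z_n)\in\mathbb{D}^n$ and $\boldsymbol{w}=(w_1,\ldots,w_m)\in\mathbb{D}^m$, where $\Theta_{\boldsymbol{k}}\in H^\infty(\mathbb{D}^m)$ for every $\boldsymbol{k}\in\mathbb{Z}_+^n$.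
   Context: $H^2(\mathbb{D}^m)$ is the Hardy space over the open unit polydisc $\mathbb{D}^m$, with coordinate functions $w_1,\ldots,w_m$. $H^2_{H_m}(\mathbb{D}^n)$ is the $H_m$-valued Hardy space over $\mathbb{D}^n$, with coordinates $z_1,\ldots,z_n$; $M_{z_j}$ is multiplication by $z_j$. $\kappa_i\in H^\infty_{\mathcal{B}(H_m)}(\mathbb{D}^n)$ is the constant function $\kappa_i(\boldsymbol{z})=M_{w_i}\in\mathcal{B}(H_m)$ (multiplication by $w_i$ on $H_m$), and $M_{\kappa_i}f=\kappa_if$. $H^\infty_{\mathcal{B}(H_m)}(\mathbb{D}^n)$ is the algebra of bounded $\mathcal{B}(H_m)$-valued analytic functions on $\mathbb{D}^n$, and $(M_\Phi f)(\boldsymbol{z})=\Phi(\boldsymbol{z})f(\boldsymbol{z})$. $H^\infty(\mathbb{D}^m)$ is the algebra of bounded holomorphic functions on $\mathbb{D}^m$, and for $\Theta\in H^\infty(\mathbb{D}^m)$, $M_\Theta$ is multiplication by $\Theta$ on $H_m$. $\boldsymbol{z}^{\boldsymbol{k}}=z_1^{k_1}\cdots z_n^{k_n}$, $\boldsymbol{w}^{\boldsymbol{l}}=w_1^{l_1}\cdots w_m^{l_m}$, $M_{\boldsymbol{z}}^{\boldsymbol{k}}=M_{z_1}^{k_1}\cdots M_{z_n}^{k_n}$; $\boldsymbol{1}$ is the constant function $1$ in $H_m$; elements of $H_m$ (such as $\boldsymbol{1}$ and $\boldsymbol{w}^{\boldsymbol{l}}$) are regarded as constant $H_m$-valued functions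 in $H^2_{H_m}(\mathbb{D}^n)$. Inner products are linear in the first variable. *)

(* Defs.v *)
From HB Require Import structures.
From mathcomp Require Import all_boot all_order all_algebra finmap.
From mathcomp Require Import all_classical all_reals topology normedtype derive.
From mathcomp Require Import ring lra.
From mathcomp Require Import complex sesquilinear.
From mathcomp.analysis.showcase Require Import summability.

Set Implicit Arguments.
Unset Strict Implicit.
Unset Printing Implicit Defensive.

Import Order.TTheory GRing.Theory Num.Theory Num.Def.
Import numFieldNormedType.Exports.

Local Open Scope classical_set_scope.
Local Open Scope ring_scope.

#[export] Existing Instance totally_filter.

(* The complex field is made a normed module over itself directly: R[i]^o cannot
   be declared complete, since the library already has a completeness instance
   keyed on ^o, for R : realType only. *)
HB.instance Definition _ (R : realType) := GRing.ComAlgebra.copy R[i] R[i]^o.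
HB.instance Definition _ (R : realType) := Vector.copy R[i] R[i]^o.
HB.instance Definition _ (R : realType) := NormedModule.copy R[i] R[i]^o.

Section complex_facts.
Context {R : realType}.
Local Notation C := R[i].
Implicit Types x y : C.
Local Open Scope complex_scope.

Lemma complex_ge0_Re x : 0 <= x -> x = (complex.Re x)%:C.
Proof. by case: x => a b; rewrite lecE /= => /andP[/eqP -> _]. Qed.

Lemma complex_gt0_Re x : 0 < x -> 0 < complex.Re x.
Proof. by case: x => a b; rewrite ltcE /= => /andP[_]. Qed.

Lemma norm_le_ReIm x : `|x| <= (`|complex.Re x| + `|complex.Im x|)%:C.
Proof.
rewrite [x in `|x|]complexE (le_trans (ler_normD _ _))// normrM.
have -> : `|'i| = 1 :> C.
  by rewrite normc_def /= expr0n expr1n add0r sqrtr1.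
rewrite mul1r rmorphD lerD//.
  by rewrite normc_def /= expr0n addr0 sqrtr_sqr.
by rewrite normc_def /= expr0n addr0 sqrtr_sqr.
Qed.

Lemma Re_norm_le x : `|complex.Re x|%:C <= `|x|.
Proof. exact: normc_ge_Re. Qed.

Lemma Im_norm_le x : `|complex.Im x|%:C <= `|x|.
Proof.
rewrite normc_def lecR -sqrtr_sqr ler_wsqrtr// lerDr sqr_ge0//.
Qed.

Lemma complex_complete (F : set_system C) :
  ProperFilter F -> cauchy F -> cvg F.
Proof.
move=> FF /cauchyP Fc.
have ReB (z w : C) : complex.Re (z - w) = complex.Re z - complex.Re w.
  by case: z w => ? ? [].
have ImB (z w : C) : complex.Im (z - w) = complex.Im z - complex.Im w.
  by case: z w => ? ? [].
have cvgp (p : C -> R) : (forall z w, p (z - w) = p z - p w) ->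
    (forall z, `|p z|%:C <= `|z|) -> cvg (p z @[z --> F]).
  move=> pB ple; apply: R_complete; apply/cauchyP => e e0.
  have [|z Fz] := Fc e%:C; first by rewrite ltcR.
  exists (p z); change (F (p @^-1` ball (p z) e)).
  apply: filterS Fz => w; rewrite -ball_normE /= => zw.
  by rewrite /ball /= -pB -ltcR (le_lt_trans (ple _)).
have /cvg_ex[/= a aF] := cvgp _ ReB Re_norm_le.
have /cvg_ex[/= b bF] := cvgp _ ImB Im_norm_le.
apply/cvg_ex; exists (a +i* b); apply/cvgrPdist_le => e e0.
have eE := complex_ge0_Re (ltW e0); have e0' := complex_gt0_Re e0.
near=> z; rewrite eE (le_trans (norm_le_ReIm _))// lecR ReB ImB /=.
rewrite [leRHS]splitr lerD//; near: z.
  by move/cvgrPdist_le : aF; apply; rewrite divr_gt0.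
by move/cvgrPdist_le : bF; apply; rewrite divr_gt0.
Unshelve. all: by end_near. Qed.

HB.instance Definition _ := Uniform_isComplete.Build C complex_complete.

End complex_facts.

(* hdot is linear in its first argument and conjugate-linear in its second. *)
HB.mixin Record isHilbert (R : realType) V
    & CompleteNormedModule R[i] V := {
  hdot : {dot V for conjC} ;
  hdotxx : forall x : V, hdot x x = `|x| ^+ 2
}.

#[short(type="hilbertType")]
HB.structure Definition Hilbert (R : realType) :=
  {V of CompleteNormedModule R[i] V & isHilbert R V}.

Section complex_hilbert.
Context {R : realType}.
Local Notation C := R[i].

Definition cdot (x y : C) : C := x * y^*.

Let cdot_bilinear : bilinear_for *%R (conjC \; *%R) cdot.
Proof.
split=> u a x y; rewrite /cdot /=.
  by rewrite mulrDl mulrA.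
by rewrite rmorphD rmorphM mulrDr !mulrA (mulrC u).
Qed.
HB.instance Definition _ := @bilinear_isBilinear.Build C C C C
  *%R (conjC \; *%R) cdot cdot_bilinear.
Let cdot_herm x y : cdot x y = (-1) ^+ false * (cdot y x)^*.
Proof. by rewrite /cdot expr0 mul1r rmorphM /= conjCK mulrC. Qed.
HB.instance Definition _ := @isHermitianSesquilinear.Build C C false conjC
  cdot cdot_herm.
Let cdot_gt0 (u : C) : u != 0 -> 0 < cdot u u.
Proof. by move=> u0; rewrite /cdot -normCK exprn_gt0// normr_gt0. Qed.
HB.instance Definition _ := @isDotProduct.Build C C cdot cdot_gt0.

Let cdotxx (x : C) : cdot x x = `|x| ^+ 2.
Proof. by rewrite /cdot normCK. Qed.
HB.instance Definition _ := isHilbert.Build R C cdotxx.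

End complex_hilbert.

Section sums.
Context {R : realType} {I : choiceType}.
Local Notation C := R[i].
Local Open Scope complex_scope.

(* Unordered summation: convergence along the net of finite subsets of I. *)
Definition has_sum {E : normedModType C} (x : I -> E) (s : E) : Prop :=
  partial_sum x @ totally --> s.

Definition norm_summable {E : normedModType C} (x : I -> E) : Prop :=
  exists M : C, forall A : {fset I}, \sum_(i <- A) `|x i| <= M.

Definition sq_summable {E : normedModType C} (x : I -> E) : Prop :=
  exists M : C, forall A : {fset I}, \sum_(i <- A) `|x i| ^+ 2 <= M.

Lemma partial_sumE {E : normedModType C} (x : I -> E) A :
  partial_sum x A = \sum_(i <- A) x i.
Proof. by rewrite /partial_sum big_seq_fsetE. Qed.

Lemma has_sumP {E : normedModType C} (x : I -> E) s :
  has_sum x s <-> forall e : C, 0 < e ->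
    exists A : {fset I}, forall B, (A `<=` B)%fset ->
      `|s - \sum_(i <- B) x i| <= e.
Proof.
rewrite /has_sum; split => [/cvgrPdist_le h e /h[A _ hA]|h].
  by exists A => B /hA /=; rewrite partial_sumE.
apply/cvgrPdist_le => e /h[A hA]; exists A => // B /hA /=.
by rewrite partial_sumE.
Qed.

Lemma has_sum_sum {E : normedModType C} (x : I -> E) s :
  has_sum x s -> sum x = s.
Proof. by move=> xs; apply: cvg_lim => //; exact: norm_hausdorff. Qed.

Lemma has_sumD {E : normedModType C} (x y : I -> E) s t :
  has_sum x s -> has_sum y t -> has_sum (x \+ y) (s + t).
Proof.
move=> xs yt; rewrite /has_sum.
have -> : partial_sum (x \+ y) = partial_sum x \+ partial_sum y.
  by apply/funext => A /=; rewrite !partial_sumE -big_split.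
exact: cvgD.
Qed.

Lemma has_sumZ {E : normedModType C} a (x : I -> E) s :
  has_sum x s -> has_sum (fun i => a *: x i) (a *: s).
Proof.
move=> xs; rewrite /has_sum.
have -> : partial_sum (fun i => a *: x i) = a \*: partial_sum x.
  by apply/funext => A /=; rewrite !partial_sumE -scaler_sumr.
exact: cvgZl_tmp.
Qed.

Lemma has_sum_conj (x : I -> C) s :
  has_sum x s -> has_sum (fun i => (x i)^*%R) (s^*%R).
Proof.
move=> /has_sumP xs; apply/has_sumP => e /xs[A hA].
by exists A => B /hA; rewrite -rmorph_sum -rmorphB norm_conjC.
Qed.

Lemma complex_ge0_approx (t : C) :
  (forall e : C, 0 < e -> exists2 r, 0 <= r & `|t - r| <= e) -> 0 <= t.
Proof.
move=> h; rewrite lecE /=; apply/andP; split.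
  rewrite -normr_le0; apply/ler_addgt0Pl => e e0; rewrite addr0.
  have [|r r0 tr] := h e%:C; first by rewrite ltcR.
  rewrite -lecR (le_trans _ tr)// (le_trans _ (Im_norm_le _))// lecR.
  by rewrite (complex_ge0_Re r0); case: (t) => a b /=; rewrite oppr0 addr0.
apply/ler_addgt0Pl => e e0.
have [|r r0 tr] := h e%:C; first by rewrite ltcR.
have := le_trans (Re_norm_le _) tr; rewrite lecR ler_norml => /andP[+ _].
move: r0; rewrite lecE => /andP[_]; case: (r) (t) => ? ? [? ?] /=; lra.
Qed.

Lemma sum_ge0_fset (x : I -> C) (A : {fset I}) :
  (forall i, 0 <= x i) -> 0 <= \sum_(i <- A) x i.
Proof. by move=> x0; rewrite big_seq sumr_ge0. Qed.

Lemma sum_fsubset {E : normedModType C} (x : I -> E) (A B : {fset I}) :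
  (A `<=` B)%fset ->
  \sum_(i <- B) x i - \sum_(i <- A) x i = \sum_(i <- (B `\` A)%fset) x i.
Proof.
move=> AB; rewrite (big_fsetID _ (mem A) B) /= addrAC.
have -> : \sum_(i <- [fset x | x in B & x \in A]%fset) x i = \sum_(i <- A) x i.
  by apply: eq_fbigl => i; rewrite !inE /= -(@in_fsetI _ B A) (fsetIidPr _).
by rewrite subrr add0r; apply: eq_fbigl => i; rewrite !inE andbC.
Qed.

Lemma has_sum_ge (x : I -> C) s (A : {fset I}) :
  (forall i, 0 <= x i) -> has_sum x s -> \sum_(i <- A) x i <= s.
Proof.
move=> x0 /has_sumP xs; rewrite -subr_ge0.
apply: complex_ge0_approx => e /xs[B hB].
have AAB : (A `<=` A `|` B)%fset by rewrite fsubsetUl.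
exists (\sum_(i <- (A `|` B)%fset) x i - \sum_(i <- A) x i).
  by rewrite sum_fsubset// sum_ge0_fset.
by rewrite opprB addrA subrK hB// fsubsetUr.
Qed.

Lemma has_sum_le (x : I -> C) s M :
  (forall A : {fset I}, \sum_(i <- A) x i <= M) -> has_sum x s -> s <= M.
Proof.
move=> xM /has_sumP xs; rewrite -subr_ge0.
apply: complex_ge0_approx => e /xs[B hB].
exists (M - \sum_(i <- B) x i); first by rewrite subr_ge0.
by rewrite opprB addrC addrA subrK distrC hB.
Qed.

Lemma norm_summable_has_sum {E : completeNormedModType C} (x : I -> E) :
  norm_summable x -> has_sum x (sum x).
Proof.
move=> [M xM]; apply: cauchy_cvg; apply: cauchy_exP => e e0.
pose u (A : {fset I}) := complex.Re (\sum_(i <- A) `|x i|).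
have uE (A : {fset I}) : \sum_(i <- A) `|x i| = (u A)%:C.
  by apply: complex_ge0_Re; rewrite sum_ge0_fset.
have supu : has_sup (range u).
  split; first by exists (u fset0); exists fset0.
  exists (complex.Re M) => _ [A _ <-].
  by have := xM A; rewrite lecE => /andP[].
have eE := complex_ge0_Re (ltW e0); have e0' := complex_gt0_Re e0.
have [_ [A _ <-] uA] := sup_adherent e0' supu.
exists (partial_sum x A); exists A => // B AB /=.
rewrite -ball_normE /= !partial_sumE distrC sum_fsubset// eE.
apply: le_lt_trans (ler_norm_sum _ _ _) _.
rewrite -(@sum_fsubset C (fun i => `|x i|))// !uE -rmorphB ltcR.
have : u B <= sup (range u).
  by apply: ub_le_sup; [case: supu|exists B].
lra.
Qed.

End sums.

Section form_norm.
Context {C : numClosedFieldType} {U : lmodType C} (form : {dot U for conjC}).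
Local Notation "''[' u , v ]" := (form u v).
Local Notation "''[' u ]" := (form u u).

Lemma dot_CauchySchwarz u v : `|'[u, v]| ^+ 2 <= '[u] * '[v].
Proof.
have [->|v0] := eqVneq v 0; first by rewrite linear0r normr0 expr0n mulr_ge0 ?dnorm_ge0.
have V0 : 0 < '[v] by rewrite dnorm_gt0.
set c := '[u, v] / '[v].
have VJ : '[v]^* = '[v] by apply: conj_Creal; rewrite ger0_real// ltW.
have := dnorm_ge0 form (u - c *: v).
rewrite dnormB dnormZ linearZr_LR /=.
have cE : c^* * '[u, v] = `|'[u, v]| ^+ 2 / '[v].
  by rewrite /c rmorphM fmorphV /= VJ normCK mulrAC [X in X / _]mulrC.
have qJ : (`|'[u, v]| ^+ 2 / '[v])^* = `|'[u, v]| ^+ 2 / '[v].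
  by rewrite rmorphM fmorphV /= VJ rmorphXn /= conj_Creal// normr_real.
have -> : `|c| ^+ 2 * '[v] = `|'[u, v]| ^+ 2 / '[v].
  rewrite /c normrM normfV (gtr0_norm V0) exprMn -mulrA; congr (_ * _).
  by rewrite expr2 -mulrA mulVf ?mulr1// gt_eqF.
rewrite cE qJ opprD addrA addrK subr_ge0.
by rewrite ler_pdivrMr.
Qed.

Lemma dot_CauchySchwarz_sqrt u v : `|'[u, v]| <= sqrtC '[u] * sqrtC '[v].
Proof.
rewrite -[leLHS]sqrCK// -sqrtCM ?nnegrE ?dnorm_ge0//.
by rewrite ler_sqrtC ?nnegrE ?exprn_ge0 ?mulr_ge0 ?dnorm_ge0// dot_CauchySchwarz.
Qed.

Lemma dot_triangle u v : sqrtC '[u + v] <= sqrtC '[u] + sqrtC '[v].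
Proof.
rewrite -ler_sqr ?nnegrE ?addr_ge0 ?sqrt_dnorm_ge0//.
rewrite sqrrD !sqrtCK dnormD addrAC lerD2r lerD2l.
have dR : '[u, v] + '[u, v]^* \is Num.real.
  by apply/CrealP; rewrite rmorphD /= conjCK addrC.
rewrite (le_trans (real_ler_norm dR))// (le_trans (ler_normD _ _))//.
by rewrite norm_conjC mulr2n lerD// dot_CauchySchwarz_sqrt.
Qed.

Lemma dot_normZ a u : sqrtC '[a *: u] = `|a| * sqrtC '[u].
Proof. by rewrite dnormZ sqrtCM ?nnegrE ?exprn_ge0 ?dnorm_ge0// sqrCK. Qed.

Lemma dot_norm_eq0 u : sqrtC '[u] = 0 -> u = 0.
Proof. by move/eqP; rewrite sqrt_dnorm_eq0 => /eqP. Qed.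

End form_norm.

Section hilbert_facts.
Context {R : realType} {E : hilbertType R}.
Implicit Types x y : E.

Lemma hdot_norm_le x y : `|hdot x y| <= `|x| * `|y|.
Proof.
have := dot_CauchySchwarz_sqrt (@hdot R E) x y.
by rewrite !hdotxx !sqrCK.
Qed.

Lemma sqrD_le (a b : R[i]) : 0 <= a -> 0 <= b -> a * b <= a ^+ 2 + b ^+ 2.
Proof.
move=> /complex_ge0_Re -> /complex_ge0_Re ->.
rewrite -!rmorphXn -rmorphM -rmorphD lecR.
by set u := complex.Re a; set v := complex.Re b; nra.
Qed.

Lemma norm_sqrD_le x y : `|x + y| ^+ 2 <= 2 * `|x| ^+ 2 + 2 * `|y| ^+ 2.
Proof.
have h : `|x + y| ^+ 2 <= (`|x| + `|y|) ^+ 2 by rewrite ler_sqr ?nnegrE ?addr_ge0// ler_normD.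
apply: le_trans h _.
have /complex_ge0_Re -> := normr_ge0 x.
have /complex_ge0_Re -> := normr_ge0 y.
set u := complex.Re _; set v := complex.Re _.
have -> : 2 = (2 : R)%:C%C :> R[i] by rewrite rmorphMn rmorph1.
rewrite -!(rmorphXn, rmorphM, rmorphD) lecR.
by have := sqr_ge0 (u - v); nra.
Qed.

End hilbert_facts.

Definition mindex (n : nat) : Type := {ffun 'I_n -> nat}.
HB.instance Definition _ n := Choice.on (mindex n).
HB.instance Definition _ n := GRing.Nmodule.on (mindex n).

Definition sq_summable_pred (R : realType) (E : hilbertType R) (n : nat) :
  {pred mindex n -> E} := fun a => `[< sq_summable a >].

Lemma sq_summable_submod (R : realType) (E : hilbertType R) n :
  submod_closed (@sq_summable_pred R E n).
Proof.
split.
  by apply/asboolP; exists 0 => A; rewrite big1// => i _; rewrite normr0 expr0n.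
move=> c a b /asboolP[M aM] /asboolP[N bN]; apply/asboolP.
exists (2 * (`|c| ^+ 2 * M) + 2 * N) => A.
apply: (@le_trans _ _ (\sum_(i <- A)
    (2 * (`|c| ^+ 2 * `|a i| ^+ 2) + 2 * `|b i| ^+ 2))).
  apply: ler_sum => i _; rewrite (le_trans (norm_sqrD_le _ _))//.
  by rewrite normrZ exprMn.
rewrite big_split -!mulr_sumr lerD// ler_wpM2l//.
by rewrite ler_wpM2l// exprn_ge0.
Qed.

HB.instance Definition _ (R : realType) (E : hilbertType R) n :=
  GRing.isSubmodClosed.Build R[i] (mindex n -> E) (@sq_summable_pred R E n)
    (@sq_summable_submod R E n).

(* The E-valued Hardy space of D^n is the space of power series
   f(z) = \sum_k a_k z^k with a_k in E and \sum_k |a_k|^2 finite, normed by the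
   square root of that sum.  An element is represented by its Taylor
   coefficients; the function on the polydisc it stands for is heval below. *)
Record hardy (R : realType) (E : hilbertType R) (n : nat) := Hardy {
  hcoef : mindex n -> E ;
  hcoefP : hcoef \in @sq_summable_pred R E n
}.

HB.instance Definition _ (R : realType) (E : hilbertType R) n :=
  [isSub for @hcoef R E n].
HB.instance Definition _ (R : realType) (E : hilbertType R) n :=
  [Choice of hardy E n by <:].
HB.instance Definition _ (R : realType) (E : hilbertType R) n :=
  [SubChoice_isSubLmodule of hardy E n by <:].

Section hardy_hilbert.
Context {R : realType} {E : hilbertType R} {n : nat}.
Local Notation C := R[i].
Implicit Types f g : hardy E n.

Definition hardy_dot f g : C := sum (fun k => hdot (hcoef f k) (hcoef g k) : C).

Lemma has_sum_hardy_dot f g :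
  has_sum (fun k => hdot (hcoef f k) (hcoef g k) : C) (hardy_dot f g).
Proof.
apply: norm_summable_has_sum.
have /asboolP[M fM] := hcoefP f; have /asboolP[N gN] := hcoefP g.
exists (M + N) => A; apply: le_trans (lerD (fM A) (gN A)).
rewrite -big_split ler_sum// => k _.
by rewrite (le_trans (hdot_norm_le _ _))// sqrD_le.
Qed.

Lemma hardy_dotP f g s :
  has_sum (fun k => hdot (hcoef f k) (hcoef g k) : C) s -> hardy_dot f g = s.
Proof. exact: has_sum_sum. Qed.

Let dot_bilinear : bilinear_for *%R (conjC \; *%R) hardy_dot.
Proof.
have H (a : C) f g h : hardy_dot (a *: f + g) h = a * hardy_dot f h + hardy_dot g h.
  apply: hardy_dotP.
  have := has_sumD (has_sumZ (a := a) (@has_sum_hardy_dot f h)) (@has_sum_hardy_dot g h).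
  congr has_sum; apply/funext => k /=.
  by rewrite linearDl linearZl_LR.
have J f g : hardy_dot g f = (hardy_dot f g)^*.
  apply: hardy_dotP; have := has_sum_conj (@has_sum_hardy_dot f g).
  by congr has_sum; apply/funext => k /=; rewrite [RHS]hermC mul1r.
split=> u a x y /=; first exact: H.
by rewrite [LHS]J H rmorphD rmorphM /= -!J.
Qed.
HB.instance Definition _ := @bilinear_isBilinear.Build C (hardy E n) (hardy E n)
  C *%R (conjC \; *%R) hardy_dot dot_bilinear.
Let dot_herm f g : hardy_dot f g = (-1) ^+ false * (hardy_dot g f)^*.
Proof.
rewrite mul1r; apply: hardy_dotP; have := has_sum_conj (@has_sum_hardy_dot g f).
by congr has_sum; apply/funext => k /=; rewrite [RHS]hermC mul1r.
Qed.
HB.instance Definition _ := @isHermitianSesquilinear.Build C (hardy E n) false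
  conjC hardy_dot dot_herm.

Lemma hardy_dot_has_sum f :
  has_sum (fun k => `|hcoef f k| ^+ 2) (hardy_dot f f).
Proof.
have := @has_sum_hardy_dot f f; congr has_sum.
by apply/funext => k /=; rewrite hdotxx.
Qed.

Lemma hardy_dot_ge f (A : {fset mindex n}) :
  \sum_(k <- A) `|hcoef f k| ^+ 2 <= hardy_dot f f.
Proof. by apply: has_sum_ge (@hardy_dot_has_sum f) => k; rewrite exprn_ge0. Qed.

Lemma hardy_dot_le f M :
  (forall A : {fset mindex n}, \sum_(k <- A) `|hcoef f k| ^+ 2 <= M) ->
  hardy_dot f f <= M.
Proof. by move=> h; apply: has_sum_le (@hardy_dot_has_sum f). Qed.

Let dot_gt0 f : f != 0 -> 0 < hardy_dot f f.
Proof.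
apply: contraNT => f0; apply/eqP/val_inj/funext => k /=.
apply/eqP; rewrite -normr_eq0 -sqrf_eq0 eq_le exprn_ge0// andbT.
have := hardy_dot_ge f [fset k]%fset; rewrite big_seq_fset1.
move=> h; rewrite (le_trans h)//.
have : 0 <= hardy_dot f f by rewrite (le_trans _ h)// exprn_ge0.
by rewrite le_eqVlt (negbTE f0) orbF => /eqP <-.
Qed.
HB.instance Definition _ := @isDotProduct.Build C (hardy E n) hardy_dot dot_gt0.

Definition hardy_norm f : C := sqrtC (hardy_dot f f).

HB.instance Definition _ := @Lmodule_isNormed.Build C (hardy E n) hardy_norm
  (@dot_triangle C (hardy E n) hardy_dot) (@dot_normZ C (hardy E n) hardy_dot)
  (@dot_norm_eq0 C (hardy E n) hardy_dot).

Lemma hardy_normE f : `|f| = hardy_norm f. Proof. by []. Qed.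

Lemma hardy_normXE f : `|f| ^+ 2 = hardy_dot f f.
Proof. by rewrite hardy_normE sqrtCK. Qed.

Lemma hcoef_norm_le f k : `|hcoef f k| <= `|f|.
Proof.
rewrite -ler_sqr ?nnegrE// hardy_normXE.
by have := hardy_dot_ge f [fset k]%fset; rewrite big_seq_fset1.
Qed.

Lemma hardy_complete (F : set_system (hardy E n)) :
  ProperFilter F -> cauchy F -> cvg F.
Proof.
move=> FF Fc; have /cauchy_ballP Fb := Fc; have /cauchyP Fe := Fc.
have coefB f g k : hcoef (f - g) k = hcoef f k - hcoef g k by [].
have cvg_coef k : cvg (hcoef f k @[f --> F]).
  apply: cauchy_cvg; apply/cauchyP => e e0; have [f Ff] := Fe e e0.
  exists (hcoef f k); change (F ((fun g => hcoef g k) @^-1` ball (hcoef f k) e)).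
  apply: filterS Ff => g; rewrite -ball_normE /= => fg.
  by rewrite -ball_normE /= -coefB (le_lt_trans (hcoef_norm_le _ _)).
pose g k : E := lim (hcoef f k @[f --> F]).
have sum_le (e : C) f : 0 < e -> F (ball f e) -> forall A : {fset mindex n},
    \sum_(k <- A) `|hcoef f k - g k| ^+ 2 <= e ^+ 2.
  move=> e0 Ff A; rewrite -subr_ge0; apply: complex_ge0_approx => d d0.
  have cvgA : \sum_(k <- A) `|hcoef f k - hcoef h k| ^+ 2 @[h --> F] -->
      \sum_(k <- A) `|hcoef f k - g k| ^+ 2.
    apply: cvg_big; [exact: add_continuous|move=> k _]; apply: cvgM; apply: cvg_norm;
      by apply: cvgB; [exact: cvg_cst|exact: cvg_coef].
  have /cvgrPdist_le/(_ d d0) Fd := cvgA.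
  have [h [fh hd]] := filter_ex (filterI Ff Fd).
  exists (e ^+ 2 - \sum_(k <- A) `|hcoef f k - hcoef h k| ^+ 2).
    rewrite subr_ge0; apply: le_trans (hardy_dot_ge (f - h) A) _.
    rewrite -hardy_normXE ler_sqr ?nnegrE ?(ltW e0)// ltW//.
  by rewrite opprB addrC addrA subrK distrC.
have [f0 Ff0] := Fe 1 ltr01.
have gP : g \in @sq_summable_pred R E n.
  have -> : g = hcoef f0 - (hcoef f0 - g) by rewrite opprB addrC subrK.
  rewrite rpredB ?hcoefP//; apply/asboolP; exists (1 ^+ 2) => A.
  exact: sum_le.
apply/cvg_ex; exists (Hardy gP); apply/cvgrPdist_le => e e0.
have : \forall f \near F, F (ball f e).
  by apply: nearP_dep; exact: Fb.
apply: filterS => f Ff; rewrite -ler_sqr ?nnegrE ?(ltW e0)// distrC.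
rewrite hardy_normXE; apply: hardy_dot_le => A; exact: sum_le.
Qed.

HB.instance Definition _ := Uniform_isComplete.Build (hardy E n) hardy_complete.
HB.instance Definition _ := isHilbert.Build R (hardy E n) (fun f => esym (hardy_normXE f)).

End hardy_hilbert.

Definition bounded_linear (R : realType) (E F : hilbertType R) :
  {pred E -> F} :=
  fun T => `[< linear T /\ exists M : R[i], forall x, `|T x| <= M * `|x| >].

Lemma bounded_linear_submod (R : realType) (E F : hilbertType R) :
  submod_closed (@bounded_linear R E F).
Proof.
split.
  apply/asboolP; split; first by move=> a x y; rewrite scaler0 addr0.
  by exists 0 => x; rewrite mul0r normr0.
move=> c S T /asboolP[Sl [M SM]] /asboolP[Tl [N TN]]; apply/asboolP; split.
  move=> a x y; rewrite !fctE Sl Tl !scalerDr !scalerA addrACA.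
  by rewrite [c * a]mulrC.
exists (`|c| * M + N) => x; rewrite mulrDl (le_trans (ler_normD _ _))//.
by rewrite lerD// normrZ -mulrA ler_wpM2l.
Qed.

HB.instance Definition _ (R : realType) (E F : hilbertType R) :=
  GRing.isSubmodClosed.Build R[i] (E -> F) (@bounded_linear R E F)
    (@bounded_linear_submod R E F).

Record bop (R : realType) (E F : hilbertType R) := Bop {
  bop_fun :> E -> F ;
  bopP : bop_fun \in @bounded_linear R E F
}.

HB.instance Definition _ (R : realType) (E F : hilbertType R) :=
  [isSub for @bop_fun R E F].
HB.instance Definition _ (R : realType) (E F : hilbertType R) :=
  [Choice of bop E F by <:].
HB.instance Definition _ (R : realType) (E F : hilbertType R) :=
  [SubChoice_isSubLmodule of bop E F by <:].

Section bop_norm.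
Context {R : realType} {E F : hilbertType R}.
Local Notation C := R[i].
Implicit Types (S T : bop E F).
Local Open Scope complex_scope.

Lemma bop_linear T : linear T.
Proof. by have /asboolP[] := bopP T. Qed.
HB.instance Definition _ T :=
  GRing.isLinear.Build C E F *:%R (bop_fun T) (bop_linear T).

Let img T : set R := [set complex.Re `|T x| | x in [set x : E | `|x| <= 1]].

Definition bop_norm T : C := (sup (img T))%:C.

Let img_sup T : has_sup (img T).
Proof.
have /asboolP[_ [M TM]] := bopP T; split.
  by exists (complex.Re `|T 0|), 0 => //=; rewrite normr0 ler01.
exists (complex.Re `|M|) => _ [x /= x1 <-].
rewrite -lecR -!complex_ge0_Re//.
rewrite (le_trans (TM x))// (le_trans (real_ler_norm _))//.
  by rewrite (ger0_real (le_trans (normr_ge0 _) (TM x))).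
by rewrite normrM normr_id ler_piMr.
Qed.

Lemma bop_norm_ge0 T : 0 <= bop_norm T.
Proof.
rewrite /bop_norm lecR; apply: (@le_trans _ _ (complex.Re `|T 0|)).
  by rewrite linear0 normr0.
apply: ub_le_sup; first by case: (img_sup T).
by exists 0 => //=; rewrite normr0 ler01.
Qed.

Lemma bop_norm_ge T x : `|T x| <= bop_norm T * `|x|.
Proof.
have [->|x0] := eqVneq x 0; first by rewrite linear0 !normr0 mulr0.
have nx0 : 0 < `|x| by rewrite normr_gt0.
rewrite -ler_pdivrMr// mulrC -[X in X * _]gtr0_norm ?invr_gt0//.
rewrite -normrZ -linearZ /bop_norm [leLHS]complex_ge0_Re// lecR.
apply: ub_le_sup; first by case: (img_sup T).
exists (`|x|^-1 *: x) => //=.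
by rewrite normrZ gtr0_norm ?invr_gt0// mulVf ?gt_eqF.
Qed.

Lemma bop_norm_le T (M : C) : 0 <= M ->
  (forall x, `|T x| <= M * `|x|) -> bop_norm T <= M.
Proof.
move=> M0 TM; rewrite /bop_norm [leRHS]complex_ge0_Re// lecR.
apply: ge_sup; first by case: (img_sup T).
move=> _ [x /= x1 <-]; rewrite -lecR -!complex_ge0_Re//.
by rewrite (le_trans (TM x))// ler_piMr.
Qed.

Let bop_normD S T : bop_norm (S + T) <= bop_norm S + bop_norm T.
Proof.
apply: bop_norm_le => [|x]; first by rewrite addr_ge0 ?bop_norm_ge0.
by rewrite mulrDl (le_trans (ler_normD _ _))// lerD ?bop_norm_ge.
Qed.

Let bop_normZ_le a T : bop_norm (a *: T) <= `|a| * bop_norm T.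
Proof.
apply: bop_norm_le => [|x]; first by rewrite mulr_ge0 ?bop_norm_ge0.
by rewrite normrZ -mulrA ler_wpM2l ?bop_norm_ge.
Qed.

Let bop_norm_eq0 T : bop_norm T = 0 -> T = 0.
Proof.
move=> T0; apply/val_inj/funext => x; apply/eqP; rewrite -normr_le0.
by rewrite (le_trans (bop_norm_ge T x))// T0 mul0r.
Qed.

Let bop_normZ a T : bop_norm (a *: T) = `|a| * bop_norm T.
Proof.
apply/eqP; rewrite eq_le bop_normZ_le /=.
have [->|a0] := eqVneq a 0; first by rewrite normr0 mul0r bop_norm_ge0.
rewrite -ler_pdivlMl ?normr_gt0// -normfV.
by rewrite -[in leLHS](scale1r T) -(mulVf a0) -scalerA bop_normZ_le.
Qed.

HB.instance Definition _ := @Lmodule_isNormed.Build C (bop E F) bop_norm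
  bop_normD bop_normZ bop_norm_eq0.

(* The adjoint is unique since hdot is definite, and exists since E and F are
   complete, so the default 0 is never used. *)
Definition adjoint T : bop F E :=
  xget 0 [set S : bop F E | forall x y, hdot (T x) y = hdot x (S y)].

End bop_norm.

Section hardy_functions.
Context {R : realType}.
Local Notation C := R[i].

Definition polydisc n : set 'rV[C]_n := [set z | forall j, `|z 0 j| < 1].

Definition zpow n (z : 'rV[C]_n) (k : mindex n) : C :=
  \prod_(j < n) z 0 j ^+ k j.

(* The series converges for z in the polydisc, which is where heval is used;
   elsewhere its value is irrelevant. *)
Definition heval (E : hilbertType R) n (f : hardy E n) (z : 'rV[C]_n) : E :=
  sum (fun k => zpow z k *: hcoef f k).

(* hmono k eta is the function z |-> z^k eta. *)
Definition hmono_coef (E : hilbertType R) n (k : mindex n) (eta : E) :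
  mindex n -> E := fun l => if l == k then eta else 0.

Lemma hmono_coefP (E : hilbertType R) n (k : mindex n) (eta : E) :
  hmono_coef k eta \in @sq_summable_pred R E n.
Proof.
apply/asboolP; exists (`|eta| ^+ 2) => A; rewrite /hmono_coef.
have [kA|kA] := boolP (k \in A).
  rewrite (big_fsetD1 k)//= eqxx big1_fset ?addr0// => l.
  by rewrite !inE => /andP[/negbTE -> _] _; rewrite normr0 expr0n.
rewrite big1_fset ?exprn_ge0// => l lA _.
by case: eqP => [lk|_]; [rewrite -lk lA in kA|rewrite normr0 expr0n].
Qed.

Definition hmono (E : hilbertType R) n (k : mindex n) (eta : E) : hardy E n :=
  Hardy (hmono_coefP k eta).

Definition hconst (E : hilbertType R) n (eta : E) : hardy E n := hmono 0 eta.

(* Bounded analytic functions on the polydisc; differentiable is complex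
   Frechet differentiability, the scalars being R[i], and for V = bop E E the
   norm is the operator norm.  The values of Phi off the polydisc play no role. *)
Definition Hinfty (V : normedModType C) n : set ('rV[C]_n -> V) :=
  [set Phi | (forall z, polydisc z -> differentiable Phi z) /\
     exists M : C, forall z, polydisc z -> `|Phi z| <= M].

Definition is_mul_op (E : hilbertType R) n (Phi : 'rV[C]_n -> bop E E)
    (T : bop (hardy E n) (hardy E n)) : Prop :=
  forall f z, polydisc z -> heval (T f) z = Phi z (heval f z).

(* mul_op Phi and smul_op theta are M_Phi and M_theta, given by their pointwise
   action on the polydisc.  This determines them, Taylor coefficients being
   determined by the values of a power series, and they exist for every Phi and
   theta in Hinfty and for the coordinate functions, so the default 0 is only
   reached for symbols that are not multipliers. *)
Definition mul_op (E : hilbertType R) n (Phi : 'rV[C]_n -> bop E E) :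
    bop (hardy E n) (hardy E n) :=
  xget 0 [set T | is_mul_op Phi T].

Definition smul_op (E : hilbertType R) n (theta : 'rV[C]_n -> C) :
    bop (hardy E n) (hardy E n) :=
  xget 0 [set T : bop (hardy E n) (hardy E n) | forall f z, polydisc z ->
     heval (T f) z = theta z *: heval f z].

Definition coord_op (E : hilbertType R) n (j : 'I_n) :
    bop (hardy E n) (hardy E n) :=
  smul_op E (fun z => z 0 j).

Definition coord_op_pow (E : hilbertType R) n (k : mindex n) :
    hardy E n -> hardy E n :=
  \big[(fun f g => f \o g)/idfun]_(j < n) iter (k j) (coord_op E j).

(* M_(kappa_i), where kappa_i(z) is multiplication by w_i for every z. *)
Definition kappa_op m n (i : 'I_m) :
    bop (hardy (hardy C m) n) (hardy (hardy C m) n) :=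
  mul_op (fun _ => coord_op C i).

End hardy_functions.

(* Main.v *)
(** Expanding in powers of z reduces everything to coefficients: T commutes with
    the M_{z_j} iff it acts as f(z) |-> Phi(z) f(z), where the k-th Taylor
    coefficient of Phi is the operator X_k sending eta to the k-th coefficient of
    T eta.  Commutation with the M_{kappa_i}^* says that X_k commutes with the
    backward shifts of H_m, i.e. that X_k^* commutes with the shifts, so that
    X_k^* is multiplication by Theta_k = X_k^* 1.

    Evaluation at z factors through the kernel vector (z^k)_k in H^2(D^n).
    Analyticity thus reduces to that of the kernel, which follows by majorizing
    the second order remainder of (z+h)^k by (|h|/rho)^2 (|z|+rho)^k, and bounds
    on symbols come from testing T against conjugate kernel vectors. *)

From HB Require Import structures.
Require Import Defs.
From mathcomp Require Import all_boot all_order all_algebra finmap.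
From mathcomp Require Import all_classical all_reals topology normedtype derive landau.
From mathcomp Require Import interval_inference ring.
From mathcomp Require Import complex sesquilinear.
From mathcomp.analysis.showcase Require Import summability.

Import Order.TTheory GRing.Theory Num.Theory.
Import numFieldNormedType.Exports.
Local Open Scope classical_set_scope.
Local Open Scope ring_scope.
Set Implicit Arguments.
Unset Strict Implicit.
Unset Printing Implicit Defensive.

(** * Unordered sums: uniqueness, bounded linear images, norm bounds, reindexing *)

Section summation.
Context {R : realType} {I : choiceType}.
Local Notation C := R[i].

Lemma has_sum_unique {V : normedModType C} (x : I -> V) s t :
  has_sum x s -> has_sum x t -> s = t.
Proof. by move=> /has_sum_sum <- /has_sum_sum <-. Qed.

Lemma has_sum_lin {V W : normedModType C} (L : V -> W) (M : C) x (s : V) :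
  linear L -> (forall v, `|L v| <= M * `|v|) ->
  has_sum x s -> has_sum (fun i : I => L (x i)) (L s).
Proof.
move=> Llin LM /has_sumP xs; apply/has_sumP => e e0.
pose Lh := GRing.isLinear.Build C V W *:%R L Llin.
pose Lf : {linear V -> W} := HB.pack L Lh.
have LE B : L (s - \sum_(i <- B) x i) = L s - \sum_(i <- B) L (x i).
  change (Lf (s - \sum_(i <- B) x i) = Lf s - \sum_(i <- B) Lf (x i)).
  by rewrite linearB linear_sum.
(* [M] may be zero, so the tolerance is divided by [|M| + 1]. *)
have M1 : 0 < `|M| + 1 by rewrite ltr_wpDl.
have [A hA] := xs _ (divr_gt0 e0 M1); exists A => B /hA h.
rewrite -LE; apply: le_trans (LM _) _.
set v := s - _ in h *.
have h1 : `|v| * (`|M| + 1) <= e by rewrite -ler_pdivlMr.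
apply: le_trans h1; rewrite mulrC.
have Mr : M * `|v| <= `|M| * `|v|.
  rewrite (le_trans (real_ler_norm _))//; last by rewrite normrM normr_id.
  by rewrite ger0_real// (le_trans _ (LM v)).
by rewrite mulrC (le_trans Mr)// mulrC ler_wpM2l// lerDl.
Qed.

(** The order on [R[i]] is partial, so [M - |s|] is shown nonnegative by approximating it with the
    nonnegative numbers [M - |\sum_(i <- B) x i|]. *)
Lemma has_sum_norm_le {V : normedModType C} (x : I -> V) s M :
  (forall A : {fset I}, `|\sum_(i <- A) x i| <= M) -> has_sum x s -> `|s| <= M.
Proof.
move=> xM /has_sumP xs; rewrite -subr_ge0; apply: complex_ge0_approx => e /xs[B hB].
exists (M - `|\sum_(i <- B) x i|); first by rewrite subr_ge0.
rewrite opprB addrC addrA subrK; apply: le_trans (ler_dist_dist _ _) _.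
by rewrite distrC hB.
Qed.

Lemma has_sum_single {V : normedModType C} (x : I -> V) k :
  (forall i, i != k -> x i = 0) -> has_sum x (x k).
Proof.
move=> x0; apply/has_sumP => e e0; exists [fset k]%fset => B.
rewrite fsub1set => kB; rewrite (big_fsetD1 k)//= big1_fset.
  by rewrite addr0 subrr normr0 ltW.
by move=> i; rewrite !inE => /andP[ik _] _; exact: x0.
Qed.

(** Gives the norm bounds of both shifts: for the forward shift [P] discards the indices without
    predecessor, for the backward one it is [predT]. *)
Lemma ler_sum_reindex {J : choiceType} (P : pred I) (phi : I -> J) (F : J -> C) (M : C) :
  {in P &, injective phi} -> (forall j, 0 <= F j) ->
  (forall B : {fset J}, \sum_(j <- B) F j <= M) ->
  forall A : {fset I}, \sum_(i <- A) (if P i then F (phi i) else 0) <= M.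
Proof.
move=> phiI F0 FM A; rewrite -big_mkcond /= big_fset_condE /=.
have := FM [fset phi i | i in [fset i in A | P i]]%fset.
rewrite big_imfset //=.
by move=> i j; rewrite !inE => /andP[_ Pi] /andP[_ Pj]; apply: phiI.
Qed.

End summation.
Arguments has_sum_lin {R I V W L} M {x s} _ _ _.
Arguments has_sum_single {R I V x} k _.

(** * Bounded operators, functionals and adjoints *)

Section bounded_operators.
Context {R : realType}.
Local Notation C := R[i].
Implicit Types E F G : hilbertType R.

Lemma bounded_linearP E F (f : E -> F) M :
  linear f -> (forall x, `|f x| <= M * `|x|) -> f \in @bounded_linear R E F.
Proof. by move=> fl fM; apply/asboolP; split=> //; exists M. Qed.

Definition bcomp E F G (T : bop F G) (S : bop E F) : bop E G.
Proof.
apply: (@Bop R E G (T \o S)).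
apply: (@bounded_linearP _ _ _ (bop_norm T * bop_norm S)) => [a x y|x] /=.
  by rewrite !linearP.
rewrite (le_trans (bop_norm_ge _ _))// -mulrA ler_wpM2l ?bop_norm_ge0//.
exact: bop_norm_ge.
Defined.

Lemma bop_ext E F (S T : bop E F) : S =1 T -> S = T.
Proof. by move=> ST; apply/val_inj/funext. Qed.

Lemma bopB E F (T : bop E F) x y : T (x - y) = T x - T y.
Proof. exact: linearB. Qed.

Lemma bopZ E F (T : bop E F) a x : T (a *: x) = a *: T x.
Proof. exact: linearZ. Qed.

Lemma bop_normrE E F (T : bop E F) : `|T| = bop_norm T. Proof. by []. Qed.

Lemma has_sum_bop E F (T : bop E F) (I : choiceType) (x : I -> E) s :
  has_sum x s -> has_sum (fun i => T (x i)) (T s).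
Proof. exact: has_sum_lin _ (bop_linear T) (bop_norm_ge T). Qed.

Lemma hdot_complex (x y : C) : hdot x y = x * y^*.
Proof. by []. Qed.

Lemma hdotC E (x y : E) : hdot x y = (hdot y x)^*.
Proof. by rewrite [LHS]hermC mul1r. Qed.

Lemma hdot_inj E (x y : E) : (forall v, hdot v x = hdot v y) -> x = y.
Proof.
move=> xy; apply/eqP; rewrite -subr_eq0 -normr_eq0 -sqrf_eq0 -hdotxx.
by rewrite linearBr /= xy subrr.
Qed.

(** Packaging [hdot] against a fixed vector as an operator lets identities between inner products be
    checked on monomials, through [hardy_op_eq]. *)
Definition dotl E (y : E) : bop E C.
Proof.
apply: (@Bop R E C (hdot^~ y)); apply: (@bounded_linearP _ _ _ `|y|) => [a u v|x].
  by rewrite linearDl linearZl_LR.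
by rewrite mulrC hdot_norm_le.
Defined.

(** The adjoint relation determines the operator because [hdot] is definite; adjoints are computed
    below by exhibiting a candidate. *)
Lemma adjointE E F (T : bop E F) (S : bop F E) :
  (forall x y, hdot (T x) y = hdot x (S y)) -> adjoint T = S.
Proof.
move=> TS; rewrite /adjoint; case: xgetP => [X _ /= TX|/(_ S)//].
by apply: bop_ext => y; apply: hdot_inj => x; rewrite -TX.
Qed.

(** The [xget] default is kept as a separate case, on which [adjoint_smul_op_bshift] splits. *)
Lemma adjointP E F (T : bop E F) :
  adjoint T = 0 \/ forall x y, hdot (T x) y = hdot x (adjoint T y).
Proof. by rewrite /adjoint; case: xgetP => [X -> TX|_]; [right|left]. Qed.

End bounded_operators.
Arguments has_sum_bop {R E F} T {I x s} _.

(** * Coefficients, norms and monomial expansions in the Hardy space *)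

Section hardy_basics.
Context {R : realType}.
Local Notation C := R[i].
Implicit Types E F : hilbertType R.

Lemma hardy_ext E n (f g : hardy E n) : hcoef f =1 hcoef g -> f = g.
Proof. by move=> fg; apply/val_inj/funext. Qed.

Lemma hcoefD E n (f g : hardy E n) k : hcoef (f + g) k = hcoef f k + hcoef g k.
Proof. by []. Qed.
Lemma hcoefB E n (f g : hardy E n) k : hcoef (f - g) k = hcoef f k - hcoef g k.
Proof. by []. Qed.
Lemma hcoefZ E n a (f : hardy E n) k : hcoef (a *: f) k = a *: hcoef f k.
Proof. by []. Qed.
Lemma hcoef_sum E n (I : Type) (r : seq I) (f : I -> hardy E n) k :
  hcoef (\sum_(i <- r) f i) k = \sum_(i <- r) hcoef (f i) k.
Proof. by elim/big_rec2 : _ => // i x y _ <-. Qed.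
Lemma hcoef_mono E n k (eta : E) l :
  hcoef (hmono (n := n) k eta) l = if l == k then eta else 0.
Proof. by []. Qed.

Lemma hdotE E n (f g : hardy E n) :
  has_sum (fun k => hdot (hcoef f k) (hcoef g k) : C) (hdot f g).
Proof. exact: has_sum_hardy_dot. Qed.

Arguments hdotE {E n} f g.

Lemma hardy_norm_ge E n (f : hardy E n) (A : {fset mindex n}) :
  \sum_(k <- A) `|hcoef f k| ^+ 2 <= `|f| ^+ 2.
Proof. by rewrite hardy_normXE; exact: hardy_dot_ge. Qed.

Lemma hardy_norm_le E n (f : hardy E n) (M : C) : 0 <= M ->
  (forall A : {fset mindex n}, \sum_(k <- A) `|hcoef f k| ^+ 2 <= M ^+ 2) ->
  `|f| <= M.
Proof.
by move=> M0 fM; rewrite -ler_sqr ?nnegrE// hardy_normXE; exact: hardy_dot_le.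
Qed.

Lemma hdot_mono E n k (eta : E) (f : hardy E n) :
  hdot (hmono k eta) f = hdot eta (hcoef f k).
Proof.
have h1 := hdotE (hmono k eta) f.
have h2 : has_sum (fun l => hdot (hcoef (hmono k eta) l) (hcoef f l) : C)
    (hdot (hcoef (hmono k eta) k) (hcoef f k)).
  by apply: (@has_sum_single _ _ _ _ k) => l lk; rewrite hcoef_mono (negbTE lk) linear0l.
by rewrite (has_sum_unique h1 h2) hcoef_mono eqxx.
Qed.

Lemma hmono_norm E n k (eta : E) : `|hmono (n := n) k eta| = `|eta|.
Proof.
apply/eqP; rewrite -(eqrXn2 (n := 2))// -!hdotxx.
by rewrite hdot_mono hcoef_mono eqxx.
Qed.

Lemma hmono_linear E n k : linear (@hmono R E n k).
Proof.
move=> a x y; apply: hardy_ext => l; rewrite hcoefD hcoefZ !hcoef_mono.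
by case: eqP => // _; rewrite scaler0 addr0.
Qed.

(** The squared norm of the remainder after [B] is the tail outside [B] of the convergent series of
    the [|f_k|^2]. *)
Lemma has_sum_hmono E n (f : hardy E n) :
  has_sum (fun k => hmono k (hcoef f k)) f.
Proof.
apply/has_sumP => e e0; have e20 : 0 < e ^+ 2 by rewrite exprn_gt0.
have /has_sumP/(_ _ e20)[A hA] := @hardy_dot_has_sum _ _ _ f; exists A => B /hA {hA}hB.
apply: hardy_norm_le; first exact: ltW.
move=> D; apply: le_trans hB.
have coefE k : hcoef (f - \sum_(l <- B) hmono l (hcoef f l)) k =
    if k \in B then 0 else hcoef f k.
  rewrite hcoefB hcoef_sum; case: ifPn => kB.
    rewrite (big_fsetD1 k)// hcoef_mono eqxx big1_fset /= ?addr0 ?subrr//.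
    by move=> l; rewrite !inE => /andP[/negbTE lk _] _; rewrite /= /hmono_coef eq_sym lk.
  rewrite big1_fset ?subr0// => l lB _; rewrite hcoef_mono.
  by case: eqP => // kl; rewrite kl lB in kB.
rewrite ger0_norm; last by rewrite subr_ge0 hardy_dot_ge.
(* The sum of [|f_k|^2] over the part of [D] outside [B] is the sum over the union minus the sum
   over [B]. *)
rewrite lerBrDr; apply: le_trans (hardy_dot_ge f (D `|` B)%fset).
rewrite -[leRHS](subrK (\sum_(i <- B) `|hcoef f i| ^+ 2)) lerD2r.
rewrite (@sum_fsubset R _ C (fun i => `|hcoef f i| ^+ 2))// ?fsubsetUr//.
have -> : ((D `|` B) `\` B)%fset = [fset k in D | k \notin B]%fset.
  by apply/fsetP => k; rewrite !inE; case: (k \in B); rewrite ?orbT ?andbF ?orbF ?andbT.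
rewrite -big_fset_condE [leRHS]big_mkcond ler_sum// => k _; rewrite coefE.
by case: ifP => _ //; rewrite normr0 expr0n.
Qed.
Arguments has_sum_hmono {E n} f.

End hardy_basics.
Arguments hdotE {R E n} f g.
Arguments has_sum_hmono {R E n} f.

(** * Density of monomials, and the pairing of scalar with vector sequences *)

Section pairing.
Context {R : realType} {n : nat}.
Local Notation C := R[i].
Implicit Types E F : hilbertType R.

(** Both operators pass through the monomial expansion of [f]. Many operator identities below are
    reduced to [hmono k eta] in this way. *)
Lemma hardy_op_ext E F (S T : bop (hardy E n) F) :
  (forall k eta, S (hmono k eta) = T (hmono k eta)) -> S = T.
Proof.
move=> ST; apply: bop_ext => f.
have := has_sum_bop T (has_sum_hmono f).
under [X in has_sum X]eq_fun do rewrite -ST.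
exact/has_sum_unique/(has_sum_bop S (has_sum_hmono f)).
Qed.

Lemma hardy_op_eq E F (S T : bop (hardy E n) F) :
  (forall k eta, S (hmono k eta) = T (hmono k eta)) -> S =1 T.
Proof. by move=> /hardy_op_ext ->. Qed.

Lemma hardy_abs_subproof E (f : hardy E n) :
  (fun k => `|hcoef f k|) \in @sq_summable_pred R C n.
Proof.
apply/asboolP; exists (`|f| ^+ 2) => A.
by under eq_bigr do rewrite normr_id; exact: hardy_norm_ge.
Qed.
Definition hardy_abs E (f : hardy E n) : hardy C n := Hardy (hardy_abs_subproof f).

Lemma hardy_abs_le E (f : hardy E n) : `|hardy_abs f| <= `|f|.
Proof.
apply: hardy_norm_le => // A /=.
by under eq_bigr do rewrite normr_id; exact: hardy_norm_ge.
Qed.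

(** Replacing coefficients by their norms gives two elements of the scalar Hardy space, where this
    is Cauchy-Schwarz for [hdot]. *)
Lemma hardy_CauchySchwarz E (c : hardy C n) (f : hardy E n) (A : {fset mindex n}) :
  \sum_(k <- A) `|hcoef c k| * `|hcoef f k| <= `|c| * `|f|.
Proof.
have h := hdotE (hardy_abs c) (hardy_abs f).
have hE : (fun k => hdot (hcoef (hardy_abs c) k) (hcoef (hardy_abs f) k) : C) =
    (fun k => `|hcoef c k| * `|hcoef f k|).
  by apply/funext => k; rewrite hdot_complex /= conj_Creal// ger0_real.
rewrite hE in h.
have x0 k : 0 <= `|hcoef c k| * `|hcoef f k| by rewrite mulr_ge0.
have h0 := has_sum_ge fset0 x0 h; rewrite big_seq_fset0 in h0.
apply: le_trans (has_sum_ge A x0 h) _; rewrite -(ger0_norm h0).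
by rewrite (le_trans (hdot_norm_le _ _))// ler_pM// hardy_abs_le.
Qed.

(** Bilinear rather than sesquilinear: with [c = (z^k)_k] it is evaluation at [z], with [c] a basis
    vector it is a Taylor coefficient, and linearity in [c] carries analyticity over from the kernel
    vector. *)
Definition pair E (c : hardy C n) (f : hardy E n) : E :=
  sum (fun k => hcoef c k *: hcoef f k).

Lemma has_sum_pair E (c : hardy C n) (f : hardy E n) :
  has_sum (fun k => hcoef c k *: hcoef f k) (pair c f).
Proof.
apply: norm_summable_has_sum; exists (`|c| * `|f|) => A.
by under eq_bigr do rewrite normrZ; exact: hardy_CauchySchwarz.
Qed.
Arguments has_sum_pair {E} c f.

Lemma pair_norm_le E (c : hardy C n) (f : hardy E n) : `|pair c f| <= `|c| * `|f|.
Proof.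
apply: has_sum_norm_le (has_sum_pair c f) => A.
rewrite (le_trans (ler_norm_sum _ _ _))//.
by under eq_bigr do rewrite normrZ; exact: hardy_CauchySchwarz.
Qed.

Lemma pair_linear_l E (f : hardy E n) : linear (fun c : hardy C n => pair c f).
Proof.
move=> a c d; apply: has_sum_sum.
have := has_sumD (has_sumZ (a := a) (has_sum_pair c f)) (has_sum_pair d f).
congr has_sum; apply/funext => k.
by rewrite hcoefD hcoefZ scalerDl -scalerA.
Qed.

Lemma pair_linear_r E (c : hardy C n) : linear (fun f : hardy E n => pair c f).
Proof.
move=> a f g; apply: has_sum_sum.
have := has_sumD (has_sumZ (a := a) (has_sum_pair c f)) (has_sum_pair c g).
congr has_sum; apply/funext => k.
by rewrite hcoefD hcoefZ scalerDr scalerA mulrC -scalerA.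
Qed.

Lemma pair_hmono_l E (f : hardy E n) k (a : C) :
  pair (hmono k a) f = a *: hcoef f k.
Proof.
have h1 := has_sum_pair (hmono k a) f.
have h2 : has_sum (fun l => hcoef (hmono k a) l *: hcoef f l)
    (hcoef (hmono k a) k *: hcoef f k).
  by apply: (has_sum_single k) => l lk; rewrite hcoef_mono (negbTE lk) scale0r.
by rewrite (has_sum_unique h1 h2) hcoef_mono eqxx.
Qed.

Lemma pair_hmono_r E (c : hardy C n) k (eta : E) :
  pair c (hmono k eta) = hcoef c k *: eta.
Proof.
have h1 := has_sum_pair c (hmono k eta).
have h2 : has_sum (fun l => hcoef c l *: hcoef (hmono k eta) l)
    (hcoef c k *: hcoef (hmono k eta) k).
  by apply: (has_sum_single k) => l lk; rewrite hcoef_mono (negbTE lk) scaler0.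
by rewrite (has_sum_unique h1 h2) hcoef_mono eqxx.
Qed.

Definition pair_op E (c : hardy C n) : bop (hardy E n) E :=
  Bop (bounded_linearP (pair_linear_r c) (pair_norm_le c)).

End pairing.
Arguments has_sum_pair {R n E} c f.

(** * Bounded operators defined by a formula for the coefficients *)

Section hardy_bop.
Context {R : realType} {V F : hilbertType R} {p : nat}.
Local Notation C := R[i].
Variables (Phi : V -> mindex p -> F) (M : C).
Hypothesis Phi_lin : forall a f g k, Phi (a *: f + g) k = a *: Phi f k + Phi g k.
Hypothesis M0 : 0 <= M.
Hypothesis Phi_le : forall f (A : {fset mindex p}),
  \sum_(k <- A) `|Phi f k| ^+ 2 <= (M * `|f|) ^+ 2.

Lemma hardy_bop_subproof f : Phi f \in @sq_summable_pred R F p.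
Proof. by apply/asboolP; exists ((M * `|f|) ^+ 2). Qed.

Lemma hardy_bop_bounded :
  (fun f => Hardy (hardy_bop_subproof f)) \in @bounded_linear R V (hardy F p).
Proof.
apply: (@bounded_linearP _ _ _ _ M) => [a f g|f].
  by apply: hardy_ext => k; rewrite hcoefD hcoefZ /= Phi_lin.
by apply: hardy_norm_le => [|A] /=; rewrite ?mulr_ge0.
Qed.

Definition hardy_bop : bop V (hardy F p) := Bop hardy_bop_bounded.

End hardy_bop.

(** * Multi-indices *)

Section multi_indices.
Context {n : nat}.
Implicit Types (j : 'I_n) (k l : mindex n).

Definition munit j : mindex n := [ffun i => nat_of_bool (i == j)].
(** The subtraction is truncated, so [mpred j] undoes the addition of [munit j], while the converse
    composite requires [0 < k j]. *)
Definition mpred j k : mindex n := [ffun i => (k i - (i == j))%N].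

Lemma mindexD k l i : (k + l) i = (k i + l i)%N.
Proof. by rewrite ffunE. Qed.

Lemma mindex0 i : (0 : mindex n) i = 0%N.
Proof. by rewrite ffunE. Qed.

Lemma munitE j i : munit j i = (i == j). Proof. by rewrite ffunE. Qed.

Lemma mindex_ext k l : k =1 l -> k = l.
Proof. by move=> kl; apply/ffunP. Qed.

Lemma mpredK j k : (0 < k j)%N -> mpred j k + munit j = k.
Proof.
move=> kj; apply: mindex_ext => i; rewrite mindexD !ffunE.
by case: eqP => [->|_]; [rewrite subnK|rewrite subn0 addn0].
Qed.

Lemma mpredD j k : mpred j (k + munit j) = k.
Proof. by apply: mindex_ext => i; rewrite ffunE mindexD munitE addnK. Qed.

Lemma mpred_eq j k l : ((0 < l j)%N && (mpred j l == k)) = (l == k + munit j).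
Proof.
apply/andP/eqP => [[l0 /eqP <-]|->]; first by rewrite mpredK.
by rewrite mpredD mindexD munitE eqxx addn1.
Qed.

End multi_indices.

(** * The kernel vector and evaluation on the polydisc *)

Section kernel.
Context {R : realType} {n : nat}.
Local Notation C := R[i].
Implicit Types (z : 'rV[C]_n) (k l : mindex n).

Lemma zpow0 z : zpow z 0 = 1.
Proof. by rewrite /zpow big1// => j _; rewrite mindex0 expr0. Qed.

Lemma zpowD z k l : zpow z (k + l) = zpow z k * zpow z l.
Proof. by rewrite /zpow -big_split; apply: eq_bigr => j _; rewrite mindexD exprD. Qed.

Lemma zpow_unit z j : zpow z (munit j) = z 0 j.
Proof.
rewrite /zpow (bigD1 j)//= munitE eqxx expr1 big1 ?mulr1// => i /negbTE ij.
by rewrite munitE ij expr0.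
Qed.

Lemma geometric_sum_le (q : C) N : 0 <= q < 1 -> \sum_(i < N) q ^+ i <= (1 - q)^-1.
Proof.
move=> /andP[q0 q1]; have q10 : 0 < 1 - q by rewrite subr_gt0.
rewrite -[leRHS]mul1r ler_pdivlMr// mulrC.
have -> : (1 - q) * \sum_(i < N) q ^+ i = 1 - q ^+ N.
  by rewrite -[RHS]opprB subrX1 -mulNr opprB.
by rewrite gerBl exprn_ge0.
Qed.

(** Any finite set of indices lies in a box [[0, N)^n], over which the sum factors into [n] finite
    geometric sums. *)
Lemma zpow_sum_le z (A : {fset mindex n}) : polydisc z ->
  \sum_(k <- A) `|zpow z k| ^+ 2 <= \prod_j (1 - `|z 0 j| ^+ 2)^-1.
Proof.
move=> zD; pose N := (\max_(k <- A) \max_(j < n) k j).+1.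
pose emb (g : {ffun 'I_n -> 'I_N}) : mindex n := [ffun j => val (g j)].
have zE k : `|zpow z k| ^+ 2 = \prod_j (`|z 0 j| ^+ 2) ^+ k j.
  rewrite /zpow normr_prod -prodrXl; apply: eq_bigr => j _.
  by rewrite normrX exprAC.
have AB : (A `<=` [fset emb g | g in {ffun 'I_n -> 'I_N}])%fset.
  apply/fsubsetP => k kA.
  have kN j : (k j < N)%N.
    rewrite ltnS (leq_trans (leq_bigmax j))//.
    exact: (leq_bigmax_seq (F := fun k : mindex n => \max_(j < n) k j)%N).
  apply/imfsetP; exists [ffun j => Ordinal (kN j)] => //.
  by apply/ffunP => j; rewrite !ffunE.
apply: le_trans (_ : _ <= \sum_(k <- [fset emb g | g in {ffun 'I_n -> 'I_N}]%fset)
    `|zpow z k| ^+ 2) _.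
  rewrite -subr_ge0 (@sum_fsubset R _ C (fun k => `|zpow z k| ^+ 2))//.
  by apply: sum_ge0_fset => k; rewrite exprn_ge0.
rewrite big_imfset /=; last first.
  by move=> g h _ _ /ffunP gh; apply/ffunP => j; apply: val_inj; have := gh j; rewrite !ffunE.
rewrite big_enum /=; under eq_bigr do rewrite zE.
have -> : \sum_(g : {ffun 'I_n -> 'I_N}) \prod_j (`|z 0 j| ^+ 2) ^+ emb g j =
    \prod_j \sum_(i < N) (`|z 0 j| ^+ 2) ^+ i.
  rewrite bigA_distr_bigA; apply: eq_bigr => g _; apply: eq_bigr => j _.
  by rewrite ffunE.
apply: ler_prod => j _; rewrite sumr_ge0 => [|i _]; last by rewrite !exprn_ge0.
by rewrite geometric_sum_le// exprn_ge0//= exprn_ilt1//; have := zD j.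
Qed.

(** The coefficients are not conjugated, to match the bilinear [pair]; the usual Szego kernel has
    the conjugate ones. [insubd] returns [0] when [zpow z] is not square summable. *)
Definition kern z : hardy C n := insubd 0 (zpow z).

Lemma hcoef_kern z : polydisc z -> hcoef (kern z) = zpow z.
Proof.
move=> zD; rewrite /kern /insubd insubT//=.
apply/asboolP; exists (\prod_j (1 - `|z 0 j| ^+ 2)^-1) => A.
exact: zpow_sum_le.
Qed.

Lemma heval_pair (E : hilbertType R) (f : hardy E n) z : polydisc z ->
  heval f z = pair_op E (kern z) f.
Proof. by move=> zD; rewrite /= /pair hcoef_kern. Qed.

Lemma heval_hmono (E : hilbertType R) k (eta : E) z : polydisc z ->
  heval (hmono k eta) z = zpow z k *: eta.
Proof. by move=> zD; rewrite heval_pair//= pair_hmono_r hcoef_kern. Qed.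

Lemma has_sum_heval (E : hilbertType R) (f : hardy E n) z : polydisc z ->
  has_sum (fun k => zpow z k *: hcoef f k) (heval f z).
Proof.
by move=> zD; rewrite heval_pair//= -hcoef_kern//; exact: has_sum_pair.
Qed.

End kernel.
Arguments has_sum_heval {R n E} f {z} _.

(** * Forward and backward shifts *)

Section shifts.
Context {R : realType} {n : nat}.
Local Notation C := R[i].
Variable (E : hilbertType R).
Implicit Types (f g : hardy E n).

Let shift_coef (j : 'I_n) f (k : mindex n) :=
  if (0 < k j)%N then hcoef f (mpred j k) else 0.

Let shift_coef_lin j a f g k :
  shift_coef j (a *: f + g) k = a *: shift_coef j f k + shift_coef j g k.
Proof. by rewrite /shift_coef; case: ifP; rewrite // scaler0 addr0. Qed.

Let shift_coef_le j f (A : {fset mindex n}) :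
  \sum_(k <- A) `|shift_coef j f k| ^+ 2 <= (1 * `|f|) ^+ 2.
Proof.
rewrite mul1r; under eq_bigr => k _.
  have -> : `|shift_coef j f k| ^+ 2 =
      if (0 < k j)%N then `|hcoef f (mpred j k)| ^+ 2 else 0.
    by rewrite /shift_coef; case: ifP => // _; rewrite normr0 expr0n.
  over.
apply: (@ler_sum_reindex _ _ _ (fun k : mindex n => 0 < k j)%N (mpred j)
  (fun k => `|hcoef f k| ^+ 2)) => [k l k0 l0 kl|k|B].
- by rewrite -(mpredK k0) kl mpredK.
- by rewrite exprn_ge0.
- exact: hardy_norm_ge.
Qed.

Definition shift_op j : bop (hardy E n) (hardy E n) :=
  hardy_bop (shift_coef_lin j) ler01 (shift_coef_le j).

Lemma hcoef_shift j f k : hcoef (shift_op j f) k =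
  if (0 < k j)%N then hcoef f (mpred j k) else 0.
Proof. by []. Qed.

Let bshift_coef (j : 'I_n) f (k : mindex n) := hcoef f (k + munit j).

Let bshift_coef_le j f (A : {fset mindex n}) :
  \sum_(k <- A) `|bshift_coef j f k| ^+ 2 <= (1 * `|f|) ^+ 2.
Proof.
rewrite mul1r; apply: (@ler_sum_reindex _ _ _ predT (fun k => k + munit j)
  (fun k => `|hcoef f k| ^+ 2)) => [k l _ _ kl|k|B].
- by rewrite -(mpredD j k) kl mpredD.
- by rewrite exprn_ge0.
- exact: hardy_norm_ge.
Qed.

Definition bshift_op j : bop (hardy E n) (hardy E n) :=
  hardy_bop (Phi := bshift_coef j) (fun _ _ _ _ => erefl) ler01 (bshift_coef_le j).

Lemma hcoef_bshift j f k : hcoef (bshift_op j f) k = hcoef f (k + munit j).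
Proof. by []. Qed.

Lemma shift_hmono j k eta : shift_op j (hmono k eta) = hmono (k + munit j) eta.
Proof.
apply: hardy_ext => l; rewrite hcoef_shift !hcoef_mono -mpred_eq.
by case: (0 < l j)%N.
Qed.

Lemma bshift_hmono j k eta : bshift_op j (hmono k eta) =
  if (0 < k j)%N then hmono (mpred j k) eta else 0.
Proof.
apply: hardy_ext => l; rewrite hcoef_bshift hcoef_mono eq_sym -mpred_eq.
by case: (0 < k j)%N => //=; rewrite eq_sym.
Qed.

Lemma hdot_bshift j f g : hdot (bshift_op j f) g = hdot f (shift_op j g).
Proof.
refine (hardy_op_eq (S := bcomp (dotl g) (bshift_op j))
  (T := dotl (shift_op j g)) _ f) => k eta.
change (hdot (bshift_op j (hmono k eta)) g = hdot (hmono k eta) (shift_op j g)).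
rewrite hdot_mono hcoef_shift bshift_hmono.
by case: ifP => _; rewrite ?hdot_mono// linear0l linear0r.
Qed.

Lemma heval_shift j f z : polydisc z ->
  heval (shift_op j f) z = z 0 j *: heval f z.
Proof.
move=> zD; rewrite !heval_pair//.
refine (hardy_op_eq (S := bcomp (pair_op E (kern z)) (shift_op j))
  (T := z 0 j *: pair_op E (kern z)) _ f) => k eta.
change (pair_op E (kern z) (shift_op j (hmono k eta)) =
  z 0 j *: pair_op E (kern z) (hmono k eta)).
by rewrite shift_hmono -!heval_pair// !heval_hmono// zpowD zpow_unit mulrC scalerA.
Qed.

End shifts.

(** * Analyticity of the kernel vector and of its bounded linear images *)

Section differentiability.
Context {R : realType}.
Local Notation C := R[i].

(** A quadratic remainder is [o(h)], and the bound on [D] supplies the continuity required of a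
    differential. *)
Lemma differentiable_quadratic (V W : normedModType C) (f : V -> W) (x : V)
    (D : V -> W) (rho K : C) : linear D -> 0 < rho -> 0 <= K ->
  (forall h, `|D h| <= K * `|h|) ->
  (forall h, `|h| <= rho -> `|f (x + h) - f x - D h| <= K * `|h| ^+ 2) ->
  differentiable f x.
Proof.
move=> Dlin rho0 K0 DK fK.
pose Dh := GRing.isLinear.Build C V W *:%R D Dlin.
pose Df : {linear V -> W} := HB.pack D Dh.
have Dc : continuous Df.
  apply/bounded_linear_continuous/linear_boundedP; exists K.
  split; first by rewrite ger0_real.
  by move=> r Kr v; rewrite (le_trans (DK v))// ler_wpM2r// ltW.
have fD : f \o shift x = cst (f x) + Df +o_ 0 id.
  apply/eqaddoP => e e0.
  have K1 : 0 < K + 1 by rewrite ltr_wpDl.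
  near=> h.
  have hr : `|h| <= rho by near: h; exact: nbhs0_le.
  have he : `|h| <= e / (K + 1) by near: h; apply: nbhs0_le; rewrite divr_gt0.
  have -> : (f \o shift x - (cst (f x) + Df)) h = f (x + h) - f x - D h.
    by rewrite fctE /= opprD addrA [h + x]addrC.
  apply: le_trans (fK h hr) _.
  rewrite expr2 mulrA ler_wpM2r// (le_trans (ler_wpM2l K0 he))//.
  by rewrite mulrCA ger_pMr// ler_pdivrMr// mul1r lerDl.
by apply/diff_locallyP; rewrite (diff_unique Dc fD).
Unshelve. all: by end_near. Qed.

Variable n : nat.
Implicit Types (z h : 'rV[C]_n) (k : mindex n).

Lemma row_norm_ge h j : `|h 0 j| <= `|h|.
Proof.
rewrite [leRHS]/Num.Def.normr /= mx_normE -[leLHS]nngE num_le.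
exact: (le_bigmax _ (fun i : 'I_1 * 'I_n => `|h i.1 i.2|%:nng) (0, j)).
Qed.

(* f has the first order expansion [c + D] at 0 on the ball of radius [rho], and
   the sizes of its terms of order 0, 1, 2 in [|h| / rho] sum to at most [M]; in
   this form the property is multiplicative in (f, M). *)
Definition expansion (rho : C) (f : 'rV[C]_n -> C) (M : C) :=
  exists (c : C) (D : 'rV[C]_n -> C) (P0 P1 P2 : C),
  [/\ linear D, [/\ 0 <= P0, 0 <= P1 & 0 <= P2], P0 + P1 + P2 <= M, `|c| <= P0 &
   (forall h, `|D h| <= `|h| / rho * P1) /\
   (forall h, `|h| <= rho -> `|f h - c - D h| <= (`|h| / rho) ^+ 2 * P2)].

Lemma expansion1 rho : expansion rho (fun=> 1) 1.
Proof.
exists 1, (fun=> 0), 1, 0, 0; split.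
- by move=> a u v; rewrite scaler0 addr0.
- by [].
- by rewrite !addr0.
- by rewrite normr1.
- by split=> h; rewrite ?subrr ?subr0 normr0 mulr0.
Qed.

Lemma expansion_coord rho z j : 0 < rho ->
  expansion rho (fun h => z 0 j + h 0 j) (`|z 0 j| + rho).
Proof.
move=> rho0; exists (z 0 j), (fun h => h 0 j), `|z 0 j|, rho, 0; split.
- by move=> a u v; rewrite !mxE.
- by split; rewrite // ltW.
- by rewrite addr0.
- by [].
- split=> h; first by rewrite mulfVK ?gt_eqF// row_norm_ge.
  by move=> _; rewrite -addrA -opprD subrr normr0 mulr0.
Qed.

(** In [(c + D + u) (d + E + v)] the first order part is [c E + D d], and six products have order at
    least 2. As [s = |h| / rho <= 1], each of these is at most [s^2] times its weight, and all nine
    weights add up to [(P0 + P1 + P2) (Q0 + Q1 + Q2)]. *)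
Lemma expansionM rho f g M N : 0 < rho -> expansion rho f M -> expansion rho g N ->
  expansion rho (fun h => f h * g h) (M * N).
Proof.
move=> rho0 [c [D [P0 [P1 [P2 [Dlin [P00 P10 P20] PM cP [DP fP]]]]]]].
move=> [d [E [Q0 [Q1 [Q2 [Elin [Q00 Q10 Q20] QN dQ [EQ gQ]]]]]]].
exists (c * d), (fun h => c * E h + D h * d), (P0 * Q0), (P0 * Q1 + P1 * Q0),
  (P0 * Q2 + P1 * Q1 + P1 * Q2 + P2 * Q0 + P2 * Q1 + P2 * Q2); split.
- by move=> a u v; rewrite Dlin Elin /GRing.scale /=; ring.
- by split; rewrite ?addr_ge0 ?mulr_ge0.
- have -> : P0 * Q0 + (P0 * Q1 + P1 * Q0) +
     (P0 * Q2 + P1 * Q1 + P1 * Q2 + P2 * Q0 + P2 * Q1 + P2 * Q2) =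
     (P0 + P1 + P2) * (Q0 + Q1 + Q2) by ring.
  by rewrite ler_pM// !addr_ge0.
- by rewrite normrM ler_pM.
split=> h.
  rewrite (le_trans (ler_normD _ _))// !normrM mulrDr lerD//.
    rewrite [leRHS]mulrCA; exact: ler_pM.
  by rewrite mulrA; exact: ler_pM.
move=> hr; set s := `|h| / rho; have s0 : 0 <= s by rewrite divr_ge0// ltW.
have s1 : s <= 1 by rewrite ler_pdivrMr// mul1r.
set u := f h - c - D h; set v := g h - d - E h.
have uP : `|u| <= s ^+ 2 * P2 by exact: fP.
have vQ : `|v| <= s ^+ 2 * Q2 by exact: gQ.
have -> : f h * g h - c * d - (c * E h + D h * d) =
    c * v + D h * E h + D h * v + u * d + u * E h + u * v.
  by rewrite /u /v; ring.
have s2 : s ^+ 2 <= 1 by rewrite exprn_ile1.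
have s2s : s * s ^+ 2 <= s ^+ 2 by rewrite ler_piMl// exprn_ge0.
have s2s2 : s ^+ 2 * s ^+ 2 <= s ^+ 2 by rewrite ler_piMl// exprn_ge0.
have step (a b x y p q : C) : 0 <= p -> 0 <= q -> `|a| <= x * p -> `|b| <= y * q ->
    x * y <= s ^+ 2 -> `|a * b| <= s ^+ 2 * (p * q).
  move=> p0 q0 ax bY xy; rewrite normrM (le_trans (ler_pM _ _ ax bY))//.
  by rewrite mulrACA ler_wpM2r// mulr_ge0.
have h1 : `|c * v| <= s ^+ 2 * (P0 * Q2).
  by apply: (step _ _ 1 (s ^+ 2)); rewrite ?mul1r.
have h2 : `|D h * E h| <= s ^+ 2 * (P1 * Q1) by apply: (step _ _ s s).
have h3 : `|D h * v| <= s ^+ 2 * (P1 * Q2) by apply: (step _ _ s (s ^+ 2)).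
have h4 : `|u * d| <= s ^+ 2 * (P2 * Q0).
  by apply: (step _ _ (s ^+ 2) 1); rewrite ?mul1r ?mulr1.
have h5 : `|u * E h| <= s ^+ 2 * (P2 * Q1).
  by apply: (step _ _ (s ^+ 2) s); rewrite // mulrC.
have h6 : `|u * v| <= s ^+ 2 * (P2 * Q2) by apply: (step _ _ (s ^+ 2) (s ^+ 2)).
clearbody u v; rewrite !mulrDr.
by do 5 (apply: le_trans (ler_normD _ _) _; apply: lerD => //).
Qed.

(** The majorant is the monomial at the radii [|z_j| + rho]; it is square summable in [k] once these
    radii are below 1. *)
Lemma expansion_zpow rho z k : 0 < rho ->
  expansion rho (fun h => zpow (z + h) k) (\prod_j (`|z 0 j| + rho) ^+ k j).
Proof.
move=> rho0.
have expX j d : expansion rho (fun h => (z 0 j + h 0 j) ^+ d) ((`|z 0 j| + rho) ^+ d).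
  elim: d => [|d IH]; first exact: expansion1.
  under eq_fun do rewrite exprS.
  by rewrite exprS; apply: expansionM => //; exact: expansion_coord.
suff H (r : seq 'I_n) : expansion rho (fun h => \prod_(j <- r) (z + h) 0 j ^+ k j)
    (\prod_(j <- r) (`|z 0 j| + rho) ^+ k j) by exact: H.
elim: r => [|j r IH].
  by under eq_fun do rewrite big_nil; rewrite big_nil; exact: expansion1.
under eq_fun do rewrite big_cons mxE.
by rewrite big_cons; apply: expansionM.
Qed.

Lemma polydisc_radius z : polydisc z ->
  exists2 rho : C, 0 < rho & forall j, `|z 0 j| + rho < 1.
Proof.
move=> zD; have f0 j : 0 < 1 - `|z 0 j| by rewrite subr_gt0.
have P0 : 0 < \prod_j (1 - `|z 0 j|) by rewrite prodr_gt0.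
(* All factors lie in [[0, 1]], so half of the product is strictly below each positive factor
   [1 - |z_j|]. *)
exists (\prod_j (1 - `|z 0 j|) / 2); first by rewrite divr_gt0.
move=> j; rewrite -ltrBrDl ltr_pdivrMr//.
rewrite (le_lt_trans (_ : _ <= 1 - `|z 0 j|))//; last by rewrite ltr_pMr ?ltr1n.
rewrite (bigD1 j)//= ler_piMr ?(ltW (f0 j))//.
by apply: prodr_ile1 => i _; rewrite (ltW (f0 i)) gerBl /= normr_ge0.
Qed.

(** The expansions of all coefficients share the radius [rho], with sizes majorized by the
    coefficients of the kernel at [r], a point of the polydisc. Their square summability assembles
    the differentials and remainders into Hardy space vectors. *)
Lemma kern_expansion z : polydisc z ->
  exists (rho K : C) (D : 'rV[C]_n -> hardy C n),
  [/\ 0 < rho, 0 <= K, linear D, (forall h, `|D h| <= K * `|h|) &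
   forall h, `|h| <= rho -> polydisc (z + h) /\
     `|kern (z + h) - kern z - D h| <= K * `|h| ^+ 2].
Proof.
move=> zD; have [rho rho0 zrho] := polydisc_radius zD.
pose r : 'rV[C]_n := \row_j (`|z 0 j| + rho).
have rE j : `|r 0 j| = `|z 0 j| + rho by rewrite mxE ger0_norm// addr_ge0// ltW.
have rD : polydisc r by move=> j; rewrite rE.
pose Q := \prod_j (1 - `|r 0 j| ^+ 2)^-1.
have Q0 : 0 <= Q by have := zpow_sum_le fset0 rD; rewrite big_seq_fset0.
have /choice[D DP] : forall k, exists D : 'rV[C]_n -> C, [/\ linear D,
    (forall h, `|D h| <= `|h| / rho * `|zpow r k|) &
    (forall h, `|h| <= rho ->
      `|zpow (z + h) k - zpow z k - D h| <= (`|h| / rho) ^+ 2 * `|zpow r k|)].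
  move=> k; have [c [D [P0 [P1 [P2 [Dlin [P00 P10 P20] PM cP [DP fP]]]]]]] :=
    expansion_zpow z k rho0.
  have RE : \prod_j (`|z 0 j| + rho) ^+ k j = `|zpow r k|.
    by rewrite /zpow normr_prod; apply: eq_bigr => j _; rewrite normrX rE.
  rewrite RE in PM.
  have PM1 : P1 <= `|zpow r k|.
    by rewrite (le_trans _ PM)// -addrA addrCA lerDl addr_ge0.
  have PM2 : P2 <= `|zpow r k| by rewrite (le_trans _ PM)// lerDr addr_ge0.
  (* The remainder bound at [h = 0] forces the constant term. *)
  have cE : c = zpow z k.
    have := fP 0; rewrite normr0 mul0r expr0n mul0r addr0 => /(_ (ltW rho0)).
    have -> : D 0 = 0.
      by have := Dlin (-1) 0 0; rewrite scaler0 addr0 scaleN1r addNr.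
    by rewrite subr0 normr_le0 subr_eq0 => /eqP.
  exists D; split=> // h; first by rewrite (le_trans (DP h))// ler_wpM2l// divr_ge0// ltW.
  by move=> hr; rewrite -cE (le_trans (fP h hr))// ler_wpM2l// exprn_ge0// divr_ge0// ltW.
have sum_le (t : C) (a : mindex n -> C) : 0 <= t ->
    (forall k, `|a k| <= t * `|zpow r k|) ->
    forall A : {fset mindex n}, \sum_(k <- A) `|a k| ^+ 2 <= (t * sqrtC Q) ^+ 2.
  move=> t0 aP A; rewrite exprMn sqrtCK.
  apply: le_trans (_ : _ <= \sum_(k <- A) t ^+ 2 * `|zpow r k| ^+ 2) _.
    by apply: ler_sum => k _; rewrite -exprMn ler_sqr// ?nnegrE ?mulr_ge0.
  by rewrite -mulr_sumr ler_wpM2l ?exprn_ge0// zpow_sum_le.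
have hr0 h : 0 <= `|h| / rho by rewrite divr_ge0// ltW.
have DS h : (fun k => D k h) \in @sq_summable_pred R C n.
  apply/asboolP; eexists => A; apply: (sum_le _ _ (hr0 h)) => k.
  by have [_ + _] := DP k; apply.
(* A single constant for two bounds: [rho^-1] serves the differential, [rho^-2] the remainder. *)
exists rho, ((rho^-1 + rho^-1 ^+ 2) * sqrtC Q), (fun h => Hardy (DS h)).
have ri0 : 0 <= rho^-1 by rewrite invr_ge0 ltW.
have sQ0 : 0 <= sqrtC Q by rewrite sqrtC_ge0.
split; first by [].
- by rewrite mulr_ge0// addr_ge0// exprn_ge0.
- move=> a u v; apply: hardy_ext => k; rewrite hcoefD hcoefZ /=.
  by have [Dl _ _] := DP k; rewrite Dl.
- move=> h; apply: le_trans (_ : _ <= `|h| / rho * sqrtC Q) _.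
    apply: hardy_norm_le; first by rewrite mulr_ge0.
    by move=> A; apply: (sum_le _ _ (hr0 h)) => k; have [_ + _] := DP k; apply.
  by rewrite [leRHS]mulrC mulrA ler_wpM2r// ler_wpM2l// lerDl exprn_ge0.
move=> h hr; have zhD : polydisc (z + h).
  move=> j; rewrite mxE (le_lt_trans (ler_normD _ _))// (le_lt_trans _ (zrho j))//.
  by rewrite lerD2l (le_trans (row_norm_ge _ _)).
split=> //; apply: le_trans (_ : _ <= (`|h| / rho) ^+ 2 * sqrtC Q) _.
  apply: hardy_norm_le; first by rewrite mulr_ge0// exprn_ge0.
  move=> A; apply: (sum_le ((`|h| / rho) ^+ 2)); first by rewrite exprn_ge0.
  move=> k; rewrite !hcoefB !hcoef_kern//=.
  by have [_ _] := DP k; apply.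
by rewrite [leRHS]mulrC exprMn [leRHS]mulrA ler_wpM2r// ler_wpM2l ?exprn_ge0// lerDr.
Qed.

(** The differential of [F] at [z] is [L \o D], with [D] that of the kernel. It is applied to
    operator-valued symbols and to scalar functions alike. *)
Lemma differentiable_kern (W : normedModType C) (F : 'rV[C]_n -> W)
    (L : hardy C n -> W) (M : C) z : linear L ->
  (forall c, `|L c| <= M * `|c|) -> (forall u, polydisc u -> F u = L (kern u)) ->
  polydisc z -> differentiable F z.
Proof.
move=> Llin LM FL zD; have [rho [K [D [rho0 K0 Dlin DK zK]]]] := kern_expansion zD.
have LM' c : `|L c| <= `|M| * `|c|.
  rewrite (le_trans (LM c))// (le_trans (real_ler_norm _))//.
    by rewrite ger0_real// (le_trans _ (LM c)).
  by rewrite normrM normr_id.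
have LB : {morph L : u v / u - v}.
  by move=> u v; rewrite [u - v]addrC -scaleN1r Llin scaleN1r addrC.
apply: (@differentiable_quadratic _ _ _ _ (L \o D) rho (`|M| * K)) => //.
- by move=> a u v /=; rewrite Dlin Llin.
- by rewrite mulr_ge0.
- by move=> h /=; rewrite -mulrA (le_trans (LM' _))// ler_wpM2l.
move=> h /zK[zhD hK]; rewrite !FL// -!LB -mulrA (le_trans (LM' _))// ler_wpM2l//.
Qed.

End differentiability.

(** * Identity theorem: values on the polydisc determine the coefficients *)

Section identity_theorem.
Context {R : realType} {E : hilbertType R} {n : nat}.
Local Notation C := R[i].
Implicit Types (f g : hardy E n) (z : 'rV[C]_n).

(** On the right the monomials free of [z_j] cancel, and the others vanish at [z_j = 0] and are
    divisible by [z_j]. *)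
Lemma heval_bshift j f z : polydisc z ->
  z 0 j *: heval (bshift_op E j f) z =
  heval f z - heval f (\row_i (if i == j then 0 else z 0 i)).
Proof.
move=> zD; set z0 := \row_i _; have z0D : polydisc z0.
  by move=> i; rewrite mxE; case: eqP => _ //; rewrite normr0.
rewrite !heval_pair//.
refine (hardy_op_eq (S := z 0 j *: bcomp (pair_op E (kern z)) (bshift_op _ j))
  (T := pair_op E (kern z) - pair_op E (kern z0)) _ f) => k eta.
change (z 0 j *: pair_op E (kern z) (bshift_op E j (hmono k eta)) =
  pair_op E (kern z) (hmono k eta) - pair_op E (kern z0) (hmono k eta)).
rewrite -!heval_pair// bshift_hmono; case: ifPn => [kj|].
  rewrite !heval_hmono// -{2 3}(mpredK kj) !zpowD !zpow_unit mxE eqxx mulr0 scale0r.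
  by rewrite subr0 scalerA mulrC.
rewrite lt0n negbK => /eqP kj.
have -> : heval 0 z = 0 :> E by rewrite heval_pair// linear0.
rewrite scaler0 !heval_hmono//; have -> : zpow z0 k = zpow z k.
  by apply: eq_bigr => i _; rewrite mxE; case: eqP => // ->; rewrite kj !expr0.
by rewrite subrr.
Qed.

(** If [a] were nonzero, [s = a / (a + M)] would give [a (a + M) <= a M], hence [a^2 <= 0]. *)
Lemma le_scaled_eq0 (a M : C) : 0 <= a -> 0 <= M ->
  (forall s, 0 < s <= 1 -> a <= s * M) -> a = 0.
Proof.
move=> a0 M0 aM; apply/eqP/negPn/negP => an0.
have a1 : 0 < a by rewrite lt_def an0.
have aM0 : 0 < a + M by rewrite ltr_pwDl.
have s1 : 0 < a / (a + M) <= 1 by rewrite divr_gt0//= ler_pdivrMr// mul1r lerDl.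
have := aM _ s1; rewrite mulrAC ler_pdivlMr// mulrDr gerDr => h.
by have := lt_le_trans (mulr_gt0 a1 a1) h; rewrite ltxx.
Qed.

(** Off the hyperplane [z_j = 0], divide [heval_bshift] by [z_j]. On it, approach [z] along the
    [j]-th axis and control the change of value by [kern_expansion]. *)
Lemma bshift_vanishing j f : (forall z, polydisc z -> heval f z = 0) ->
  forall z, polydisc z -> heval (bshift_op E j f) z = 0.
Proof.
move=> f0; set g := bshift_op E j f.
have g0 u : polydisc u -> u 0 j != 0 -> heval g u = 0.
  move=> uD uj; have := heval_bshift j f uD; rewrite !f0//.
    by rewrite subr0 => /eqP; rewrite scaler_eq0 (negbTE uj) => /eqP.
  by move=> i; rewrite mxE; case: eqP => _ //; rewrite normr0.
move=> z zD; have [zj|/g0] := eqVneq (z 0 j) 0; last exact.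
have [rho [K [D [rho0 K0 Dlin DK zK]]]] := kern_expansion zD.
pose e : 'rV[C]_n := delta_mx 0 j.
apply/eqP; rewrite -normr_eq0; apply/eqP.
(* The constant bounds [K |h|^2 + K |h|] when [|h| <= s rho] and [s <= 1], with one factor [s] taken
   out. *)
apply: (@le_scaled_eq0 _ ((K * rho ^+ 2 + K * rho) * `|g|)) => //.
  by rewrite mulr_ge0// addr_ge0// mulr_ge0// ?exprn_ge0// ltW.
move=> s /andP[s0 s1].
have e1 : 0 < `|e| + 1 by rewrite ltr_wpDl.
(* Dividing by [|e| + 1] ensures [|h| <= s rho] without computing [|e|]. *)
pose t := s * rho / (`|e| + 1); have t0 : 0 < t by rewrite divr_gt0// mulr_gt0.
pose h := t *: e.
have hs : `|h| <= s * rho.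
  rewrite normrZ gtr0_norm// -mulrA ger_pMr ?mulr_gt0//.
  by rewrite mulrC ler_pdivrMr// mul1r lerDl.
have hr : `|h| <= rho by rewrite (le_trans hs)// ler_piMl// ltW.
have [zhD hK] := zK h hr.
have gh : heval g (z + h) = 0.
  by apply: g0 => //; rewrite !mxE zj add0r !eqxx mulr1 gt_eqF.
rewrite -[heval g z]opprK normrN -[- _]add0r -gh !heval_pair//=.
have -> : pair (kern (z + h)) g - pair (kern z) g = pair (kern (z + h) - kern z) g.
  by rewrite -scaleN1r addrC -pair_linear_l scaleN1r addrC.
rewrite (le_trans (pair_norm_le _ _))// mulrA ler_wpM2r//.
rewrite -[kern _ - _](subrK (D h)) (le_trans (ler_normD _ _))// mulrDr lerD//.
  rewrite (le_trans hK)// [leRHS]mulrCA ler_wpM2l//.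
  rewrite (le_trans (_ : _ <= (s * rho) ^+ 2))//.
    by rewrite ler_sqr ?nnegrE// mulr_ge0// ltW.
  rewrite exprMn ler_wpM2r ?exprn_ge0 ?(ltW rho0)//.
  by rewrite expr2 ler_piMl// ltW.
by rewrite (le_trans (DK h))// [leRHS]mulrCA ler_wpM2l.
Qed.

Lemma kern0 : kern 0 = hmono 0 (1 : C) :> hardy C n.
Proof.
apply: hardy_ext => k; rewrite hcoef_kern => [|j]; last by rewrite mxE normr0.
rewrite hcoef_mono; case: eqP => [->|k0]; first exact: zpow0.
have [j kj] : exists j, k j != 0%N.
  apply: contra_notP k0 => /forallNP k0; apply: mindex_ext => j.
  by rewrite mindex0; have /negP := k0 j; rewrite negbK => /eqP.
by rewrite /zpow (bigD1 j)//= mxE expr0n (negbTE kj) mul0r.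
Qed.

(* If f vanishes on the polydisc, so do its iterated backward shifts, whose
   values at 0 are the Taylor coefficients of f. *)
Lemma heval_eq0 f : (forall z, polydisc z -> heval f z = 0) -> f = 0.
Proof.
move=> f0; apply: hardy_ext => k.
have [N] := ubnP (\sum_j k j)%N; elim: N f f0 k => // N IH f f0 k kN.
have [/existsP[j kj]|/existsPn k0] := boolP [exists j, 0 < k j]%N.
  rewrite -(mpredK kj) -hcoef_bshift; apply: IH; first exact: bshift_vanishing.
  move: kN; rewrite -{1}(mpredK kj); under eq_bigr do rewrite mindexD.
  rewrite big_split /= [X in (_ + X)%N](bigD1 j)//= munitE eqxx.
  by rewrite addSn addnS ltnS => /(leq_trans _); apply; rewrite ltnS leq_addr.
have D0 : polydisc (0 : 'rV[C]_n) by move=> j; rewrite mxE normr0.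
have -> : k = 0.
  by apply: mindex_ext => j; rewrite mindex0; have := k0 j; rewrite lt0n negbK => /eqP.
by have := f0 0 D0; rewrite heval_pair//= kern0 pair_hmono_l scale1r.
Qed.

Lemma heval_inj f g : (forall z, polydisc z -> heval f z = heval g z) -> f = g.
Proof.
move=> fg; apply/eqP; rewrite -subr_eq0; apply/eqP/heval_eq0 => z zD.
by rewrite heval_pair// bopB -!heval_pair// fg// subrr.
Qed.

End identity_theorem.

(** * Multiplication operators and the commutant of the shifts *)

Section operators.
Context {R : realType}.
Local Notation C := R[i].
Implicit Types E F : hilbertType R.

Definition hmono_op E n (k : mindex n) : bop E (hardy E n).
Proof.
apply: (Bop (bounded_linearP (hmono_linear k) (M := 1) _)) => eta.
by rewrite mul1r hmono_norm.
Defined.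

Section coefficientwise.
Context {E F : hilbertType R} {n : nat}.
Variable X : bop E F.

Let map_lin a (f g : hardy E n) k :
  X (hcoef (a *: f + g) k) = a *: X (hcoef f k) + X (hcoef g k).
Proof. by rewrite hcoefD hcoefZ linearP. Qed.

Let map_le (f : hardy E n) (A : {fset mindex n}) :
  \sum_(k <- A) `|X (hcoef f k)| ^+ 2 <= (bop_norm X * `|f|) ^+ 2.
Proof.
apply: le_trans (_ : _ <= \sum_(k <- A) bop_norm X ^+ 2 * `|hcoef f k| ^+ 2) _.
  apply: ler_sum => k _; rewrite -exprMn ler_sqr ?nnegrE ?mulr_ge0 ?bop_norm_ge0//.
  exact: bop_norm_ge.
by rewrite -mulr_sumr exprMn ler_wpM2l ?exprn_ge0 ?bop_norm_ge0 ?hardy_norm_ge.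
Qed.

(** Multiplication by the constant symbol [X]; both [kappa_op] and its adjoint have this form. *)
Definition hmap : bop (hardy E n) (hardy F n) :=
  hardy_bop map_lin (bop_norm_ge0 X) map_le.

Lemma hcoef_hmap f k : hcoef (hmap f) k = X (hcoef f k). Proof. by []. Qed.

Lemma hmap_hmono k eta : hmap (hmono k eta) = hmono k (X eta).
Proof.
apply: hardy_ext => l; rewrite hcoef_hmap !hcoef_mono.
by case: eqP => // _; rewrite linear0.
Qed.

Lemma heval_hmap f z : polydisc z -> heval (hmap f) z = X (heval f z).
Proof.
move=> zD; rewrite !heval_pair//.
refine (hardy_op_eq (S := bcomp (pair_op F (kern z)) hmap)
  (T := bcomp X (pair_op E (kern z))) _ f) => k eta.
change (pair_op F (kern z) (hmap (hmono k eta)) =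
  X (pair_op E (kern z) (hmono k eta))).
by rewrite hmap_hmono -!heval_pair// !heval_hmono// linearZ.
Qed.

End coefficientwise.

Lemma hdot_hmap E F n (X : bop E F) (Y : bop F E) (f : hardy E n) g :
  (forall x y, hdot (X x) y = hdot x (Y y)) -> hdot (hmap X f) g = hdot f (hmap Y g).
Proof.
move=> XY; have h1 := hdotE (hmap X f) g; have h2 := hdotE f (hmap Y g).
have hE : (fun k => hdot (hcoef (hmap X f) k) (hcoef g k) : C) =
  (fun k => hdot (hcoef f k) (hcoef (hmap Y g) k)).
  by apply/funext => k; rewrite !hcoef_hmap XY.
by rewrite hE in h1; exact: has_sum_unique h1 h2.
Qed.

Lemma hdot_shift E n j (f g : hardy E n) :
  hdot (shift_op E j f) g = hdot f (bshift_op E j g).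
Proof. by rewrite hdotC -hdot_bshift -hdotC. Qed.

(** By the identity theorem the pointwise action determines the operator, so exhibiting [T] is
    enough. *)
Lemma smul_opE E n (theta : 'rV[C]_n -> C) (T : bop (hardy E n) (hardy E n)) :
  (forall f z, polydisc z -> heval (T f) z = theta z *: heval f z) ->
  smul_op E theta = T.
Proof.
move=> TP; rewrite /smul_op; case: xgetP => [S _ /= SP|/(_ T)//].
by apply: bop_ext => f; apply: heval_inj => z zD; rewrite SP// TP.
Qed.

Lemma coord_opE E n j : coord_op E j = shift_op E j :> bop (hardy E n) _.
Proof. by apply: smul_opE => f z zD; exact: heval_shift. Qed.

Lemma smul_opP E n (theta : 'rV[C]_n -> C) : smul_op E theta = 0 \/
  forall f z, polydisc z -> heval (smul_op E theta f) z = theta z *: heval f z.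
Proof. by rewrite /smul_op; case: xgetP => [S -> SP|_]; [right|left]. Qed.

Lemma mul_opE E n (Phi : 'rV[C]_n -> bop E E) (T : bop (hardy E n) (hardy E n)) :
  is_mul_op Phi T -> mul_op Phi = T.
Proof.
move=> TP; rewrite /mul_op; case: xgetP => [S _ /= SP|/(_ T)//].
by apply: bop_ext => f; apply: heval_inj => z zD; rewrite SP// TP.
Qed.

Lemma kappa_opE m n (i : 'I_m) : kappa_op n i = hmap (shift_op C i).
Proof. by rewrite /kappa_op coord_opE; apply: mul_opE => f z; exact: heval_hmap. Qed.

Lemma adjoint_kappa m n (i : 'I_m) :
  adjoint (kappa_op n i) = hmap (bshift_op C i) :> bop (hardy (hardy C m) n) _.
Proof.
rewrite kappa_opE; apply: adjointE => f g.
by apply: hdot_hmap => x y; exact: hdot_shift.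
Qed.

Lemma heval_coord_op_pow E n k (f : hardy E n) z : polydisc z ->
  heval (coord_op_pow k f) z = zpow z k *: heval f z.
Proof.
move=> zD; have hiter j d g :
    heval (iter d (coord_op E j) g) z = z 0 j ^+ d *: heval g z.
  elim: d => [|d IH]; first by rewrite expr0 scale1r.
  by rewrite iterS coord_opE heval_shift// -coord_opE IH scalerA exprS.
rewrite /coord_op_pow /zpow; elim: (index_enum _) f => [|j r IH] f.
  by rewrite !big_nil scale1r.
by rewrite !big_cons /= hiter IH scalerA.
Qed.

Lemma coord_op_pow_hconst E n k (eta : E) :
  coord_op_pow k (hconst n eta) = hmono k eta.
Proof.
apply: heval_inj => z zD; rewrite heval_coord_op_pow// !heval_hmono//.
by rewrite zpow0 scale1r.
Qed.

Lemma commute_coord_op_pow E n (T : bop (hardy E n) (hardy E n)) k f :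
  (forall j, T \o coord_op E j = coord_op E j \o T) ->
  T (coord_op_pow k f) = coord_op_pow k (T f).
Proof.
move=> TC; have hiter j d g : T (iter d (coord_op E j) g) = iter d (coord_op E j) (T g).
  by elim: d => //= d <-; exact: (congr1 (fun u => u _) (TC j)).
rewrite /coord_op_pow; elim: (index_enum _) f => [|j r IH] f.
  by rewrite !big_nil.
by rewrite !big_cons /= hiter IH.
Qed.

(* An operator commuting with the shifts satisfies
   [T (z^k eta) = z^k T eta], so its value at z sees only f(z). *)
Lemma heval_commutant E n (T : bop (hardy E n) (hardy E n)) f z :
  (forall j, T \o coord_op E j = coord_op E j \o T) -> polydisc z ->
  heval (T f) z = heval (T (hconst n (heval f z))) z.
Proof.
move=> TC zD; rewrite !heval_pair//.
pose ev := pair_op E (kern z).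
refine (hardy_op_eq (S := bcomp ev T)
  (T := bcomp ev (bcomp T (bcomp (hmono_op E 0) ev))) _ f) => k eta.
change (ev (T (hmono k eta)) = ev (T (hconst n (ev (hmono k eta))))).
rewrite /ev -!heval_pair// heval_hmono// -coord_op_pow_hconst commute_coord_op_pow//.
rewrite heval_coord_op_pow//.
have -> : hconst n (zpow z k *: eta) = zpow z k *: hconst n eta.
  exact: (bopZ (hmono_op E (0 : mindex n))).
by rewrite bopZ !heval_pair// bopZ.
Qed.

(** * Norm bounds on symbols from conjugate kernel vectors *)

Section multiplier_bound.
Context {E : hilbertType R} {n : nat}.
Variable z : 'rV[C]_n.
Hypothesis zD : polydisc z.

Let ckern_sum (xi : E) (A : {fset mindex n}) :
  \sum_(k <- A) `|(zpow z k)^* *: xi| ^+ 2 <= (`|kern z| * `|xi|) ^+ 2.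
Proof.
under eq_bigr do rewrite normrZ exprMn norm_conjC.
by rewrite -mulr_suml exprMn ler_wpM2r ?exprn_ge0// -hcoef_kern// hardy_norm_ge.
Qed.

Let ckernP (xi : E) : (fun k => (zpow z k)^* *: xi) \in @sq_summable_pred R E n.
Proof. by apply/asboolP; exists ((`|kern z| * `|xi|) ^+ 2) => A; exact: ckern_sum. Qed.

(** The Szego kernel at [z] in direction [xi]; [hdot_ckern] is its reproducing property. *)
Let ckern (xi : E) : hardy E n := Hardy (ckernP xi).

Let ckern_norm (xi : E) : `|ckern xi| <= `|kern z| * `|xi|.
Proof. by apply: hardy_norm_le => [|A]; rewrite ?mulr_ge0 ?ckern_sum. Qed.

Let hdot_ckern f xi : hdot f (ckern xi) = hdot (heval f z) xi.
Proof.
rewrite heval_pair//; refine (hardy_op_eq (S := dotl (ckern xi))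
  (T := bcomp (dotl xi) (pair_op E (kern z))) _ f) => k eta.
change (hdot (hmono k eta) (ckern xi) = hdot (pair_op E (kern z) (hmono k eta)) xi).
rewrite -heval_pair// heval_hmono// hdot_mono linearZl_LR linearZr_LR /=.
by rewrite conjCK.
Qed.

Let heval_ckern xi : heval (ckern xi) z = `|kern z| ^+ 2 *: xi.
Proof.
have h1 := has_sum_heval (ckern xi) zD.
have h2 := hdotE (kern z) (kern z); rewrite hdotxx in h2.
have h3 : has_sum (fun k => hdot (hcoef (kern z) k) (hcoef (kern z) k) *: xi)
    (`|kern z| ^+ 2 *: xi).
  apply: (has_sum_lin (L := fun a : C => a *: xi) `|xi| _ _ h2) => [a u v|v].
    by rewrite scalerDl scalerA.
  by rewrite normrZ mulrC.
apply: has_sum_unique h1 _; move: h3; congr has_sum; apply/funext => k.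
by rewrite hcoef_kern// hdot_complex -scalerA.
Qed.

(** With [xi = B eta], and [f] the multiple of [ckern eta] whose value at [z] is [eta], the inner
    product of [T f] with [ckern xi] is [|xi|^2]. The powers of [q] in the norms of [f] and
    [ckern xi] cancel, so the bound is uniform in [z]. *)
Lemma multiplier_norm_le (T : bop (hardy E n) (hardy E n)) (B : E -> E) eta :
  (forall f, heval (T f) z = B (heval f z)) -> `|B eta| <= `|T| * `|eta|.
Proof.
move=> TB; set xi := B eta; set q := `|kern z|.
have q0 : 0 < q.
  rewrite normr_gt0; apply/eqP => k0.
  have := zpow0 z; rewrite -hcoef_kern// k0 => /eqP.
  by rewrite eq_sym oner_eq0.
pose f := (q ^+ 2)^-1 *: ckern eta.
have fz : heval f z = eta.
  rewrite heval_pair// bopZ -heval_pair// heval_ckern scalerA mulVf ?scale1r//.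
  by rewrite expf_neq0// gt_eqF.
have h : `|xi| ^+ 2 <= `|T| * `|eta| * `|xi|.
  have -> : `|xi| ^+ 2 = `|hdot (T f) (ckern xi)|.
    by rewrite hdot_ckern TB fz hdotxx ger0_norm// exprn_ge0.
  have fN : `|f| <= q^-1 * `|eta|.
    rewrite normrZ ger0_norm ?invr_ge0 ?exprn_ge0 ?(ltW q0)//.
    rewrite (le_trans (ler_wpM2l _ (ckern_norm eta)))// ?invr_ge0 ?exprn_ge0 ?(ltW q0)//.
    by rewrite -/q expr2 invfM -mulrA mulKf// gt_eqF.
  have TfN : `|T f| <= `|T| * (q^-1 * `|eta|).
    by rewrite (le_trans (bop_norm_ge T f))// ler_wpM2l// bop_norm_ge0.
  have -> : `|T| * `|eta| * `|xi| = `|T| * (q^-1 * `|eta|) * (q * `|xi|).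
    by field; rewrite gt_eqF.
  by rewrite (le_trans (hdot_norm_le _ _))// ler_pM// -/q ckern_norm.
have [->|xi0] := eqVneq xi 0; first by rewrite normr0 mulr_ge0.
by move: h; rewrite expr2 ler_pM2r// normr_gt0.
Qed.

End multiplier_bound.

End operators.

(** * Adjoints of operators defined on the scalar Hardy space *)

Section scalar_adjoint.
Context {R : realType} {m : nat} {F : hilbertType R}.
Local Notation C := R[i].
Variable X : bop (hardy C m) F.
Let e (l : mindex m) : hardy C m := hmono l (1 : C).
Let adj_coef (y : F) (l : mindex m) : C := hdot y (X (e l)).

Let adj_coef_lin a y y' l :
  adj_coef (a *: y + y') l = a *: adj_coef y l + adj_coef y' l.
Proof. by rewrite /adj_coef linearDl linearZl_LR. Qed.

(** Duality: for [v] the combination of the [e l] with coefficients [adj_coef y l], one has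
    [|v|^2 = s = hdot y (X v)], hence [|v|^2 <= |X| |y| |v|]. *)
Let adj_coef_le y (A : {fset mindex m}) :
  \sum_(l <- A) `|adj_coef y l| ^+ 2 <= (bop_norm X * `|y|) ^+ 2.
Proof.
set s := \sum_(l <- A) _; have s0 : 0 <= s.
  by apply: sum_ge0_fset => l; rewrite exprn_ge0.
pose v : hardy C m := \sum_(l <- A) adj_coef y l *: e l.
have vE : `|v| ^+ 2 = s.
  rewrite -hdotxx {1}/v linear_sumlz; apply: eq_big_seq => l lA.
  rewrite linearZl_LR; transitivity (adj_coef y l * hdot (1 : C) (hcoef v l)).
    by congr (_ * _); exact: hdot_mono.
  rewrite hdot_complex mul1r normCK; congr (_ * _^*).
  rewrite hcoef_sum (big_fsetD1 l)//= big1_fset.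
    rewrite /= addr0; change (adj_coef y l * (if l == l then 1 else 0) = adj_coef y l).
    by rewrite eqxx mulr1.
  move=> k; rewrite !inE => /andP[/negbTE kl _] _.
  change (adj_coef y k * (if l == k then 1 else 0) = 0).
  by rewrite eq_sym kl mulr0.
have sE : hdot y (X v) = s.
  rewrite /v linear_sum linear_sumr; apply: eq_bigr => l _.
  by rewrite linearZ linearZr_LR /= mulrC -normCK.
have [->|sn0] := eqVneq s 0; first by rewrite exprn_ge0// mulr_ge0 ?bop_norm_ge0.
have s1 : 0 < s by rewrite lt_def sn0.
rewrite -(ler_pM2r s1) -expr2 -vE -exprMn ler_sqr ?nnegrE ?mulr_ge0 ?exprn_ge0 ?bop_norm_ge0//.
rewrite vE -[leLHS](ger0_norm s0) -sE (le_trans (hdot_norm_le _ _))//.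
by rewrite mulrC [leRHS]mulrAC ler_wpM2r// bop_norm_ge.
Qed.

(** The adjoint in the orthonormal basis of monomials. At [y = 1] its coefficients are [<1, X w^l>],
    the source of the formula for [Theta_k]. *)
Definition hadj : bop F (hardy C m) :=
  hardy_bop adj_coef_lin (bop_norm_ge0 X) adj_coef_le.

Lemma hcoef_hadj y l : hcoef (hadj y) l = hdot y (X (hmono l (1 : C))).
Proof. by []. Qed.

Lemma hdot_hadj x y : hdot (X x) y = hdot x (hadj y).
Proof.
refine (hardy_op_eq (S := bcomp (dotl y) X) (T := dotl (hadj y)) _ x) => l a.
change (hdot (X (hmono l a)) y = hdot (hmono l a) (hadj y)).
rewrite hdot_mono hcoef_hadj hdot_complex -hdotC.
have -> : hmono l a = a *: e l.
  apply: hardy_ext => k; rewrite hcoefZ !hcoef_mono.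
  by case: eqP => _; rewrite ?scaler0// [RHS]mulr1.
by rewrite bopZ linearZl_LR.
Qed.

End scalar_adjoint.

(** * The operator-valued symbol *)

Section symbol.
Context {R : realType} {E : hilbertType R} {n : nat}.
Local Notation C := R[i].
Variable T : bop (hardy E n) (hardy E n).

(* [symbol c] is the value at z of the symbol of T when c = (z^k)_k, and the
   k-th coefficient of this symbol when c is the k-th basis vector. *)
Definition symbol (c : hardy C n) : bop E E :=
  bcomp (pair_op E c) (bcomp T (hmono_op E 0)).

Lemma symbolE c eta : symbol c eta = pair c (T (hconst n eta)).
Proof. by []. Qed.

Lemma symbol_linear : linear symbol.
Proof. by move=> a c d; apply: bop_ext => eta; exact: pair_linear_l. Qed.

Lemma symbol_norm_le c : `|symbol c| <= `|T| * `|c|.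
Proof.
rewrite bop_normrE; apply: bop_norm_le => [|eta].
  by rewrite mulr_ge0 ?bop_norm_ge0.
rewrite symbolE (le_trans (pair_norm_le _ _))// mulrAC [leRHS]mulrC ler_wpM2l//.
by rewrite (le_trans (bop_norm_ge _ _))// hmono_norm.
Qed.

Lemma symbol_hmono k a eta : symbol (hmono k a) eta = a *: hcoef (T (hconst n eta)) k.
Proof. by rewrite symbolE pair_hmono_l. Qed.

Lemma heval_symbol z f : (forall j, T \o coord_op E j = coord_op E j \o T) ->
  polydisc z -> heval (T f) z = symbol (kern z) (heval f z).
Proof. by move=> TC zD; rewrite heval_commutant// symbolE heval_pair. Qed.

(** Image of the monomial expansion of [kern z] under the bounded linear map [symbol]; the series
    thus converges in operator norm. *)
Lemma symbol_has_sum z : polydisc z ->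
  has_sum (fun k => zpow z k *: symbol (hmono k (1 : C))) (symbol (kern z)).
Proof.
move=> zD; have := has_sum_lin _ symbol_linear symbol_norm_le (has_sum_hmono (kern z)).
congr has_sum; apply/funext => k; apply: bop_ext => eta.
by rewrite symbol_hmono hcoef_kern// -[in LHS](scale1r (hcoef _ k)) -symbol_hmono.
Qed.

(** Analyticity is inherited from the kernel. For boundedness, [symbol_norm_le] would leave a factor
    [|kern z|] depending on [z]; [multiplier_norm_le] gives [|T|]. *)
Lemma Hinfty_symbol : (forall j, T \o coord_op E j = coord_op E j \o T) ->
  Hinfty (fun z => symbol (kern z)).
Proof.
move=> TC; split=> [z zD|].
  exact: (differentiable_kern symbol_linear symbol_norm_le).
exists `|T| => z zD; rewrite bop_normrE; apply: bop_norm_le => [|eta]; first exact: bop_norm_ge0.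
by apply: (multiplier_norm_le zD) => f; exact: heval_symbol.
Qed.

End symbol.
Arguments symbol_has_sum {R E n} T {z} _.

(** * Operators on [H_m] commuting with the backward shifts *)

Section commuting_with_backward_shifts.
Context {R : realType} {m : nat}.
Local Notation C := R[i].
Variable X : bop (hardy C m) (hardy C m).
Hypothesis XC : forall i f, X (bshift_op C i f) = bshift_op C i (X f).

Let theta w := heval (hadj X (hconst m (1 : C))) w.

(** Taking adjoints in [XC], [hadj X] commutes with the shifts, so [heval_commutant] applies; values
    being scalars, the constant function [f(w)] is [f(w)] times [1]. *)
Lemma heval_hadj f w : polydisc w -> heval (hadj X f) w = theta w *: heval f w.
Proof.
move=> wD; rewrite heval_commutant//; last first.
  move=> i; apply/funext => g /=; rewrite coord_opE.
  by apply: hdot_inj => x; rewrite -hdot_hadj -!hdot_bshift -XC -hdot_hadj.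
have -> : hconst m (heval f w) = heval f w *: hconst m (1 : C).
  apply: hardy_ext => k; rewrite hcoefZ !hcoef_mono.
  by case: eqP => _; rewrite ?scaler0// [RHS]mulr1.
pose Y := bcomp (pair_op C (kern w)) (hadj X).
have YE g : heval (hadj X g) w = Y g by exact: heval_pair.
by rewrite /theta !YE (bopZ Y); exact: mulrC.
Qed.

Lemma smul_op_hadj : smul_op C theta = hadj X.
Proof. by apply: smul_opE => f w; exact: heval_hadj. Qed.

Lemma adjoint_hadj : adjoint (smul_op C theta) = X.
Proof.
rewrite smul_op_hadj; apply: adjointE => x y.
by rewrite hdotC -hdot_hadj -hdotC.
Qed.

Lemma Hinfty_hadj : Hinfty theta.
Proof.
pose t := hadj X (hconst m (1 : C)); split=> [w wD|].
  have tM (c : hardy C m) : `|pair c t| <= `|t| * `|c|.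
    by rewrite mulrC pair_norm_le.
  have tE u : polydisc u -> theta u = pair (kern u) t by exact: heval_pair.
  exact: (differentiable_kern (pair_linear_l t) tM tE wD).
exists `|hadj X| => w wD.
(* The bound for the scalar symbol is read off at [eta = 1]. *)
have := @multiplier_norm_le _ _ _ _ wD (hadj X) (fun a : C => theta w *: a) 1
  (fun f => heval_hadj f wD).
by rewrite normr1 mulr1; have -> : theta w *: (1 : C) = theta w by exact: mulr1.
Qed.

End commuting_with_backward_shifts.

(** * The converse implication and the characterization *)

(** Adjoint form of the commutation of multiplication by [theta] with multiplication by [w_i]; in
    the default cases both sides vanish. *)
Lemma adjoint_smul_op_bshift (R : realType) m (theta : 'rV[R[i]]_m -> R[i]) i f :
  adjoint (smul_op R[i] theta) (bshift_op R[i] i f) =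
  bshift_op R[i] i (adjoint (smul_op R[i] theta) f).
Proof.
have [->|aP] := adjointP (smul_op R[i] theta); first by rewrite [RHS]linear0.
apply: hdot_inj => x; rewrite -aP -hdot_shift -hdot_shift -aP.
congr (hdot _ f).
have [->|sP] := smul_opP R[i] theta; first by rewrite [LHS]linear0.
apply: heval_inj => w wD; rewrite heval_shift// !sP// heval_shift//.
by rewrite !scalerA mulrC.
Qed.

(** On values at [z], the scalar [z_j] passes through the linear map [Phi z]. Backward shifts
    commute with every term of the series of [Phi z], hence by continuity with its sum. *)
Lemma commute_of_multiplier (R : realType) m n
    (T : bop (hardy (hardy R[i] m) n) (hardy (hardy R[i] m) n))
    (Theta : mindex n -> 'rV[R[i]]_m -> R[i])
    (Phi : 'rV[R[i]]_n -> bop (hardy R[i] m) (hardy R[i] m)) :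
  (forall z, polydisc z -> has_sum
     (fun k => zpow z k *: adjoint (smul_op R[i] (Theta k))) (Phi z)) ->
  is_mul_op Phi T ->
  (forall j, T \o coord_op (hardy R[i] m) j = coord_op (hardy R[i] m) j \o T) /\
  (forall i : 'I_m, T \o adjoint (kappa_op n i) = adjoint (kappa_op n i) \o T).
Proof.
move=> PhiS TM; split=> [j|i]; apply/funext => f /=; apply: heval_inj => z zD.
  by rewrite coord_opE TM// !heval_shift// TM// bopZ.
rewrite adjoint_kappa TM// !heval_hmap// TM//.
set x := heval f z.
have ev eta : has_sum
    (fun k => zpow z k *: adjoint (smul_op R[i] (Theta k)) eta) (Phi z eta).
  by apply: (has_sum_lin (L := fun S : bop _ _ => S eta) `|eta| _ _ (PhiS z zD))
    => // S; rewrite mulrC bop_norm_ge.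
have h := has_sum_bop (bshift_op R[i] i) (ev x).
apply: has_sum_unique (ev _) _; move: h; congr has_sum; apply/funext => k.
by rewrite bopZ adjoint_smul_op_bshift.
Qed.

Theorem theorem3p3 (R : realType) (m n : nat) (hm : (0 < m)%N) (hn : (0 < n)%N)
    (T : bop (hardy (hardy R[i] m) n) (hardy (hardy R[i] m) n)) :
  ((forall j : 'I_n, T \o coord_op (hardy R[i] m) j =
                     coord_op (hardy R[i] m) j \o T) /\
   (forall i : 'I_m, T \o adjoint (kappa_op n i) =
                     adjoint (kappa_op n i) \o T))
  <->
  exists (Theta : mindex n -> 'rV[R[i]]_m -> R[i])
         (Phi : 'rV[R[i]]_n -> bop (hardy R[i] m) (hardy R[i] m)),
    [/\ (forall k : mindex n, Hinfty (Theta k)),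
        (forall (k : mindex n) (w : 'rV[R[i]]_m), polydisc w ->
           has_sum (fun l : mindex m =>
             hdot (coord_op_pow k (hconst n (hconst m (1 : R[i]))))
                  (T (hconst n (hmono l (1 : R[i])))) * zpow w l)
             (Theta k w)),
        Hinfty Phi,
        (forall z : 'rV[R[i]]_n, polydisc z ->
           has_sum (fun k : mindex n =>
             zpow z k *: adjoint (smul_op R[i] (Theta k))) (Phi z))
      & is_mul_op Phi T].
Proof.
split=> [[TC TK]|[th [Phi [_ _ _ PhiS TM]]]]; last exact: commute_of_multiplier PhiS TM.
pose X k := symbol T (hmono k (1 : R[i])).
have XC k i f : X k (bshift_op R[i] i f) = bshift_op R[i] i (X k f).
  rewrite !symbol_hmono !scale1r.
  (* On constant functions the adjoint of [kappa_op] acts by the backward shift on the value; [XC]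
     is then the [k]-th coefficient of [TK]. *)
  have -> : hconst n (bshift_op R[i] i f) = adjoint (kappa_op n i) (hconst n f).
    by rewrite adjoint_kappa /hconst hmap_hmono.
  have /= -> := congr1 (fun u => u (hconst n f)) (TK i).
  by rewrite adjoint_kappa.
exists (fun k => heval (hadj (X k) (hconst m (1 : R[i])))), (fun z => symbol T (kern z)).
split.
- by move=> k; exact: Hinfty_hadj.
(* By [hdot_mono], [<z^k 1, T w^l>] is [<1, X_k w^l>], the [l]-th coefficient of the adjoint of
   [X_k] at [1]. *)
- move=> k w wD; have := has_sum_heval (hadj (X k) (hconst m (1 : R[i]))) wD.
  congr has_sum; apply/funext => l; rewrite coord_op_pow_hconst hdot_mono hcoef_hadj.
  by rewrite symbol_hmono scale1r; exact: mulrC.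
- exact: Hinfty_symbol.
- move=> z zD; have := symbol_has_sum T zD; congr has_sum; apply/funext => k.
  by rewrite adjoint_hadj.
- by move=> f z zD; exact: heval_symbol.
Qed.
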